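(* Let $\boldsymbol{X}$ be a $W_p$ scale mixture random vector in $\mathbb{R}^d$, $d\ge 2$, with parameters $A,F,g,I,p$, i.e. $\boldsymbol{X}\stackrel{d}{=}A\boldsymbol{S}$ with $\boldsymbol{S}_I= R\,W\,\boldsymbol{U}_I$, $\boldsymbol{S}_J= R\,W_p\,\boldsymbol{U}_J$, $W=(1-W_p^p)^{1/p}$, where $R\sim F$ and $W_p$ has density $g:(0,1)\to(0,\infty)$. Assume that $A_{JI}$ has all entries equal to $0$ and that Assumption A1 (stated in the context) is satisfied. If $\boldsymbol{a}\in\mathbb{R}^d$ is such that $F(\|\boldsymbol{a}_J\|_A)\in(0,1)$, then we have the stochastic representation $$\bigl(\boldsymbol{X}_I \,\big|\, \boldsymbol{X}_J=\boldsymbol{a}_J\bigr)\ \stackrel{d}{=}\ A_{II}\,R_{F,g,\|\boldsymbol{a}_J\|_A}\,\boldsymbol{U}_I + A_{IJ}A_{JJ}^{-1}\boldsymbol{a}_J,$$ where $\boldsymbol{U}_I$ is independent of the positive random variable $R_{F,g,\|\boldsymbol{a}_J\|_A}$, which has distribution function $Q_{F,g,\|\boldsymbol{a}_J\|_A}$, where for $\tau\in(0,x_F)$ $$Q_{F,g,\tau}(z)=1-\frac{\int_{(\tau^p+z^p)^{1/p}}^{x_F} g(\tau/r)\frac1r\,dF(r)}{\int_{\tau}^{x_F} g(\tau/r)\frac1r\,dF(r)},\qquad z\in\bigl(0,(x_F^p-\tau^p)^{1/p}\bigr).$$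
   Context: $\stackrel{d}{=}$ denotes equality of distributions. $I$ is a non-empty subset of $\{1,\dots,d\}$ with $m=|I|<d$ elements and $J=\{1,\dots,d\}\setminus I$. For $\boldsymbol{x}\in\mathbb{R}^d$, $\boldsymbol{x}_I=(x_i,i\in I)^\top$ and $\boldsymbol{x}_J=(x_i,i\in J)^\top$; for $A\in\mathbb{R}^{d\times d}$, $A_{II},A_{IJ},A_{JI},A_{JJ}$ are the submatrices with rows and columns in the corresponding index sets, and $A_{JJ}^{-1}=(A_{JJ})^{-1}$. $\|\cdot\|_I$ and $\|\cdot\|_J$ are given norms on $\mathbb{R}^m$ and $\mathbb{R}^{d-m}$, and $\|\boldsymbol{x}_J\|_A:=\|A_{JJ}^{-1}\boldsymbol{x}_J\|_J$. $p\in(0,\infty)$ is fixed. $\boldsymbol{U}$ is a random vector in $\mathbb{R}^d$ with $\|\boldsymbol{U}_I\|_I=\|\boldsymbol{U}_J\|_J=1$ almost surely and $\boldsymbol{U}_I$ independent of $\boldsymbol{U}_J$. $x_F\in(0,\infty]$ is the upper endpoint of the distribution function $F$. A $W_p$ scale mixture random vector with parameters $A,F,g,I,p$ is a random vector $\boldsymbol{X}\stackrel{d}{=}A\boldsymbol{S}$, $A\in\mathbb{R}^{d\times d}$, with $\boldsymbol{S}_I\stackrel{d}{=}RW\boldsymbol{U}_I$, $\boldsymbol{S}_J\stackrel{d}{=}RW_p\boldsymbol{U}_J$ (jointly), $W:=(1-W_p^p)^{1/p}$, where $R>0$ almost surely has distribution function $F$, $W_p\in[0,1]$ almost surely has a positive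 density function $g$ on $(0,1)$, and $R,W,\boldsymbol{U}_I,\boldsymbol{U}_J$ are mutually independent. Assumption A1: if $K\subset J$ and $J\setminus K$ has exactly one element, then $\boldsymbol{U}_K$ possesses a positive density function defined for all $\boldsymbol{u}_K\in\mathbb{R}^{|K|}$ with $\boldsymbol{u}\in\mathbb{R}^d$ such that $\|\boldsymbol{u}_J\|_J=1$; when $J$ has only one element, instead $P\{\boldsymbol{U}_J=1\}>0$; further, $A_{JJ}^{-1}$ exists. $(\boldsymbol{X}_I\mid\boldsymbol{X}_J=\boldsymbol{a}_J)$ denotes a random vector whose law is the (regular) conditional distribution of $\boldsymbol{X}_I$ given $\boldsymbol{X}_J=\boldsymbol{a}_J$; as usual, the asserted identity means that the right-hand side provides a version of this conditional distribution. *)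

(* Defs.v *)
From HB Require Import structures.
From mathcomp Require Import all_boot all_order all_algebra.
From mathcomp Require Import all_classical all_reals all_analysis.

Set Implicit Arguments.
Unset Strict Implicit.
Unset Printing Implicit Defensive.

Import Order.TTheory GRing.Theory Num.Theory.
Import numFieldNormedType.Exports.

Local Open Scope classical_set_scope.
Local Open Scope ring_scope.

Definition measure_matrix_display : measure_display -> measure_display.
Proof. exact. Qed.

(* Matrices carry the product sigma-algebra, generated by the entries (as the
   library does for tuples); on real matrices this is the Borel sigma-algebra. *)
Section measurable_matrix.
Context {d : measure_display} {T : measurableType d} (m n : nat).

Definition entries_preimage : set_system 'M[T]_(m, n) :=
  \bigcup_(ij in [set: 'I_m * 'I_n])
    preimage_set_system setT (fun M : 'M[T]_(m, n) => M ij.1 ij.2) measurable.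

Let matrix_set0 : <<s entries_preimage >> set0.
Proof. exact: sigma_algebra0. Qed.

Let matrix_setC A : <<s entries_preimage >> A -> <<s entries_preimage >> (~` A).
Proof. exact: sigma_algebraC. Qed.

Let matrix_bigcup (F : (set 'M[T]_(m, n))^nat) :
  (forall i, <<s entries_preimage >> (F i)) ->
  <<s entries_preimage >> (\bigcup_i F i).
Proof. exact: sigma_algebra_bigcup. Qed.

HB.instance Definition _ := @isMeasurable.Build (measure_matrix_display d)
  'M[T]_(m, n) (<<s entries_preimage >>) matrix_set0 matrix_setC matrix_bigcup.

End measurable_matrix.

Lemma measurable_entry d (T : measurableType d) m n (i : 'I_m) (j : 'I_n) :
  measurable_fun setT (fun M : 'M[T]_(m, n) => M i j).
Proof.
move=> _ B mB; rewrite setTI; apply: sub_sigma_algebra.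
by exists (i, j) => //; exists B; rewrite ?setTI.
Qed.

Lemma measurable_fun_matrix d1 (T1 : measurableType d1) d (T : measurableType d)
    m n (f : T1 -> 'M[T]_(m, n)) :
  (forall i j, measurable_fun setT (fun x => f x i j)) -> measurable_fun setT f.
Proof.
move=> mf; apply: (@measurability _ _ _ _ setT f (@entries_preimage d T m n)) => //.
move=> _ [_ [[i j] _ [B mB <-]] <-]; rewrite !setTI.
by rewrite -[X in measurable X]setTI; exact: mf.
Qed.

Section lebesgue_vec.
Context {R : realType}.

Definition vec_cons n (z : measurableTypeR R * 'cV[R]_n) : 'cV[R]_n.+1 :=
  \col_i if unlift ord0 i is Some j then z.2 j 0 else z.1.

Lemma measurable_vec_cons n : measurable_fun setT (@vec_cons n).
Proof.
apply: measurable_fun_matrix => i j; rewrite /vec_cons.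
under eq_fun do rewrite mxE.
case: unliftP => [k _|_]; last exact: measurable_fst.
by apply: (measurableT_comp (measurable_entry k 0)); exact: measurable_snd.
Qed.

Definition vec_uncons n (v : 'cV[R]_n.+1) : measurableTypeR R * 'cV[R]_n :=
  (v ord0 0, \col_j v (lift ord0 j) 0).

Lemma vec_consK n : cancel (@vec_cons n) (@vec_uncons n).
Proof.
move=> [x v]; rewrite /vec_uncons /vec_cons mxE unlift_none; congr pair.
by apply/colP => j; rewrite !mxE liftK.
Qed.

Lemma measurable_vec_uncons n : measurable_fun setT (@vec_uncons n).
Proof.
apply/measurable_fun_pairP; split; first exact: measurable_entry.
apply: measurable_fun_matrix => i j; rewrite /vec_uncons /=.
by under eq_fun do rewrite mxE; exact: measurable_entry.
Qed.

Section cons_measure.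
Variables (n : nat) (mu : {sigma_finite_measure set 'cV[R]_n -> \bar R}).

Definition cons_measure :=
  pushforward (@lebesgue_measure R \x mu)%E (@vec_cons n).

Let cons_measure0 : cons_measure set0 = 0%E.
Proof. by rewrite /cons_measure /pushforward preimage_set0 measure0. Qed.

Let cons_measure_ge0 A : (0 <= cons_measure A)%E.
Proof. by rewrite /cons_measure /pushforward measure_ge0. Qed.

Let cons_measure_sigma_additive : semi_sigma_additive cons_measure.
Proof.
by apply: measure_semi_sigma_additive; exact: measurable_vec_cons.
Qed.

HB.instance Definition _ := isMeasure.Build _ _ _ cons_measure
  cons_measure0 cons_measure_ge0 cons_measure_sigma_additive.

Let cons_measure_sigma_finite : sigma_finite setT cons_measure.
Proof.
have /sigma_finiteP[F [TF ndF Foo]] := sigma_finiteT (@lebesgue_measure R).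
have /sigma_finiteP[G [TG ndG Goo]] := sigma_finiteT mu.
exists (fun k => @vec_uncons n @^-1` (F k `*` G k)).
  rewrite -preimage_bigcup (_ : \bigcup_k (F k `*` G k) = setT) ?preimage_setT//.
  rewrite -setXTT TF TG predeqE => -[x y]; split.
    by move=> [k _ []/= ? ?]; split; exists k.
  move=> [/= [k _ Fkx] [l _ Gly]]; exists (maxn k l) => //; split.
  - by move: x Fkx; exact/subsetPset/ndF/leq_maxl.
  - by move: y Gly; exact/subsetPset/ndG/leq_maxr.
move=> k; have [mF Fk] := Foo k; have [mG Gk] := Goo k; split.
  by rewrite -[X in measurable X]setTI; apply: measurable_vec_uncons => //;
    exact: measurableX.
rewrite /cons_measure /pushforward -comp_preimage.
rewrite (_ : _ \o _ = id) ?preimage_id; last exact/funext/vec_consK.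
by rewrite product_measure1E// lte_mul_pinfty// ge0_fin_numE.
Qed.

HB.instance Definition _ := Measure_isSigmaFinite.Build _ _ _ cons_measure
  cons_measure_sigma_finite.

End cons_measure.

Fixpoint lebesgue_vec n : {sigma_finite_measure set 'cV[R]_n -> \bar R} :=
  match n with
  | 0 => \d_(0 : 'cV[R]_0)
  | k.+1 => cons_measure (lebesgue_vec k)
  end.

End lebesgue_vec.

Section vectors.
Context {R : realType}.

Definition is_norm n (N : 'cV[R]_n -> R) : Prop :=
  [/\ forall x y, N (x + y) <= N x + N y,
      forall (c : R) x, N (c *: x) = `|c| * N x
    & forall x, N x = 0 -> x = 0].

Definition subvec d (K : {set 'I_d}) (x : 'cV[R]_d) : 'cV[R]_#|K| :=
  rowsub (@enum_val _ (mem K)) x.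

Definition submat d (K L : {set 'I_d}) (A : 'M[R]_d) : 'M[R]_(#|K|, #|L|) :=
  mxsub (@enum_val _ (mem K)) (@enum_val _ (mem L)) A.

(* The norm x_J |-> || A_JJ^-1 x_J ||_J on R^J. *)
Definition norm_sub d (J : {set 'I_d}) (A : 'M[R]_d) (N : 'cV[R]_#|J| -> R)
    (x : 'cV[R]_#|J|) : R :=
  N (invmx (submat J J A) *m x).

End vectors.

Section probability_notions.
Context {R : realType}.

Definition eq_distribution d1 d2 d' (T1 : measurableType d1)
    (T2 : measurableType d2) (T' : measurableType d')
    (P1 : probability T1 R) (X1 : T1 -> T')
    (P2 : probability T2 R) (X2 : T2 -> T') : Prop :=
  forall B, measurable B -> P1 (X1 @^-1` B) = P2 (X2 @^-1` B).

Definition sigma_of d d' (T : measurableType d) (T' : measurableType d')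
    (X : T -> T') : set_system T :=
  preimage_set_system setT X measurable.

Definition mutually_independent d (T : measurableType d) (P : probability T R)
    (s : seq (set_system T)) : Prop :=
  forall (K : {set 'I_(size s)}) (E : 'I_(size s) -> set T),
    (forall i, i \in K -> nth set0 s i (E i)) ->
    P (\bigcap_(i in [set` K]) E i) = (\prod_(i in K) P (E i))%E.

(* X has a density with respect to mu which is positive on D and vanishes
   outside D; the values of h outside D are irrelevant. *)
Definition has_positive_density d d' (T : measurableType d)
    (T' : measurableType d') (P : probability T R) (X : T -> T')
    (mu : {measure set T' -> \bar R}) (D : set T') (h : T' -> R) : Prop :=
  [/\ measurable_fun D h, forall x, D x -> 0 < h x
    & forall B, measurable B ->
        P (X @^-1` B) = (\int[mu]_(x in B `&` D) (h x)%:E)%E].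

(* kappa is a version of the conditional distribution of X given Y. *)
Definition is_cond_distribution d d1 d2 (T : measurableType d)
    (T1 : measurableType d1) (T2 : measurableType d2) (P : probability T R)
    (X : T -> T1) (Y : T -> T2) (kappa : R.-pker T2 ~> T1) : Prop :=
  forall (B : set T1) (C : set T2), measurable B -> measurable C ->
    P (X @^-1` B `&` Y @^-1` C) = (\int[P]_(w in Y @^-1` C) kappa (Y w) B)%E.

End probability_notions.

Section scale_mixtures.
Context {R : realType}.

(* W = (1 - Wp ^ p) ^ (1 / p) *)
Definition compl_weight (p : R) (T : Type) (Wp : T -> R) : T -> R :=
  fun w => (1 - Wp w `^ p) `^ p^-1.

(* X is a W_p scale mixture random vector with parameters A, F, g, I, p; the
   sample space of X need not be that of the ingredients Rad, Wp, U. *)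
Record Wp_scale_mixture n (A : 'M[R]_n) (F : cumulativeBounded (0 : R) (1 : R))
    (g : R -> R) (I : {set 'I_n}) (p : R)
    (NI : 'cV[R]_#|I| -> R) (NJ : 'cV[R]_#|~: I| -> R)
    d (T : measurableType d) (P : probability T R) (X : {RV P >-> 'cV[R]_n})
    d' (T' : measurableType d') (P' : probability T' R)
    (Rad Wp : {RV P' >-> R}) (U S : {RV P' >-> 'cV[R]_n}) : Prop := {
  Rad_gt0 : {ae P', forall w, 0 < Rad w};
  Rad_df : forall r, cdf Rad r = (F r)%:E;
  Wp_itv : {ae P', forall w, 0 <= Wp w <= 1};
  Wp_density : has_positive_density (T' := measurableTypeR R) P' Wp
    lebesgue_measure `]0, 1[ g;
  U_sphere : {ae P', forall w,
    NI (subvec I (U w)) = 1 /\ NJ (subvec (~: I) (U w)) = 1};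
  indep_RWU : mutually_independent P'
    [:: sigma_of Rad; sigma_of (compl_weight p Wp);
        sigma_of (subvec I \o U); sigma_of (subvec (~: I) \o U)];
  S_I : forall w,
    subvec I (S w) = (Rad w * compl_weight p Wp w) *: subvec I (U w);
  S_J : forall w, subvec (~: I) (S w) = (Rad w * Wp w) *: subvec (~: I) (U w);
  X_AS : eq_distribution P X P' (fun w => A *m S w)
}.

Definition assumption_A1 n (A : 'M[R]_n) (I : {set 'I_n})
    (NJ : 'cV[R]_#|~: I| -> R)
    d' (T' : measurableType d') (P' : probability T' R)
    (U : {RV P' >-> 'cV[R]_n}) : Prop :=
  let J := ~: I in
  [/\ forall K : {set 'I_n}, (1 < #|J|)%N -> K \subset J -> #|J :\: K| = 1%N ->
        exists h : 'cV[R]_#|K| -> R,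
          has_positive_density P' (subvec K \o U) (lebesgue_vec #|K|)
            [set subvec K u | u in [set u | NJ (subvec J u) = 1]] h,
      #|J| = 1%N -> (0 < P' [set w | subvec J (U w) = const_mx 1%R])%E
    & submat J J A \in unitmx].

Variables (p : R) (F : cumulativeBounded (0 : R) (1 : R)) (g : R -> R).

Definition upper_endpoint : \bar R := ereal_sup [set r%:E | r in [set r | F r < 1]].

(* The Stieltjes integrals against dF run over ]s, x_F]: a possible atom of F at
   x_F counts, one at s does not (g is not defined at 1). *)
Definition radial_dom (s : R) : set R :=
  [set r | s < r /\ (r%:E <= upper_endpoint)%E].

(* The denominator of Q_{F,g,tau} is finite; as g may be unbounded, this can
   fail for exceptional values of tau. *)
Definition radial_integrable (tau : R) : Prop :=
  (lebesgue_stieltjes_measure F).-integrable (radial_dom tau)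
    (fun r => (g (tau / r) / r)%:E).

Definition radial_integral (tau s : R) : R :=
  \int[lebesgue_stieltjes_measure F]_(r in radial_dom s) (g (tau / r) / r).

(* The distribution function Q_{F,g,tau}, on the whole line: for
   z >= (x_F ^ p - tau ^ p) ^ (1 / p) the numerator is an integral over the
   empty set, so the value is 1. *)
Definition Qdf (tau z : R) : R :=
  if 0 < z then
    1 - radial_integral tau ((tau `^ p + z `^ p) `^ p^-1)
        / radial_integral tau tau
  else 0.

End scale_mixtures.

(* Main.v *)
Require Import Defs.
From HB Require Import structures.
From mathcomp Require Import all_boot all_order all_algebra.
From mathcomp Require Import all_classical all_reals all_analysis.
From mathcomp Require Import measurable_realfun lra.

Import Order.TTheory GRing.Theory Num.Theory.
Import numFieldNormedType.Exports.
Import HBNNSimple.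

Local Open Scope classical_set_scope.
Local Open Scope ring_scope.

(** Since A_JI = 0, the vector X_J is A_JJ S_J, so conditioning on X_J = a_J
    fixes S_J = A_JJ^-1 a_J. As U_J lies on the unit sphere of the norm on R^J,
    this means fixing both T := R W_p = tau, where tau is the norm of S_J, and
    the direction U_J = S_J / tau. The direction carries no information on
    (R, W, U_I), and U_I carries none on (R, W, U_J). Hence U_I keeps its law,
    and only the law of R W given T = tau is left to find.

    That law is one-dimensional. The pair (T, R) has density g(t/r)/r on
    0 < t < r with respect to dt dF(r): substitute t = r w in the integral of
    g(w) dw dF(r) and exchange the integrals ([integral_radial]). Normalizing
    g(tau/r)/r dF(r) on r > tau gives the law of R given T = tau
    ([radial_law], [integral_radial_law]); the normalizing constant is the
    density of T at tau, which integrates to 1 and so is finite for almost every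
    tau ([radial_finite_ae]). Finally R^p = (R W_p)^p + (R W)^p, so that
    R W = (R^p - tau^p)^(1/p), and R W > z holds exactly when
    R > (tau^p + z^p)^(1/p): this turns the law of R into the distribution
    function Q ([cdf_radial_law]).

    The conditional distribution itself is the law of
    A_II (r^p - tau^p)^(1/p) y + A_IJ A_JJ^-1 a_J when r has the law above and
    y, independent of r, has the law of U_I ([cond_kernel]). It is a version of
    the conditional distribution because the identity for (T, R) holds for all
    nonnegative measurable functions: integrating against the laws of U_I and
    U_J, which are independent of (R, W_p), extends it to the whole vector
    ([radial_disintegration], [cond_kernel_distribution]). *)

Set Implicit Arguments.
Unset Strict Implicit.
Unset Printing Implicit Defensive.

(** * Measures given by a density *)

Section density.
Context d (T : measurableType d) (R : realType).
Local Open Scope ereal_scope.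
Variables (mu : {measure set T -> \bar R}) (g : T -> R).

(** The measurability and positivity proofs are arguments, so that the measure
    structure can be inferred from the term. *)
Definition with_density (mg : measurable_fun setT g)
    (g0 : forall x, (0 <= g x)%R) (B : set T) : \bar R :=
  \int[mu]_(x in B) (g x)%:E.

Variables (mg : measurable_fun setT g) (g0 : forall x, (0 <= g x)%R).
Local Notation nu := (with_density mg g0).

Let with_density0 : nu set0 = 0.
Proof. exact: integral_set0. Qed.

Let with_density_ge0 B : 0 <= nu B.
Proof. by apply: integral_ge0 => x _; rewrite lee_fin. Qed.

Let with_density_sigma_additive : semi_sigma_additive nu.
Proof.
move=> B mB tB mUB; rewrite /with_density ge0_integral_bigcup//=.
- by apply: is_cvg_ereal_nneg_natsum_cond => n _ _; exact: with_density_ge0.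
- by apply: measurable_funTS; exact/measurable_EFinP.
- by move=> x _; rewrite lee_fin.
Qed.

HB.instance Definition _ := isMeasure.Build _ _ _ nu
  with_density0 with_density_ge0 with_density_sigma_additive.

Let mgE : measurable_fun setT (EFin \o g).
Proof. exact/measurable_EFinP. Qed.

(** The rule holds for indicators by assumption, hence for simple functions, and
    passes to increasing limits. *)
Lemma ge0_integral_density (m1 : {measure set T -> \bar R}) (f : T -> \bar R) :
  (forall B, measurable B -> m1 B = nu B) ->
  measurable_fun setT f -> (forall x, 0 <= f x) ->
  \int[m1]_x f x = \int[mu]_x ((g x)%:E * f x).
Proof.
move=> mE mf f0; pose h := nnsfun_approx measurableT mf.
have fcvg x : EFin \o h ^~ x @ \oo --> f x by exact: cvg_nnsfun_approx.
have fE x : limn (EFin \o h ^~ x) = f x by exact/cvg_lim.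
under eq_integral do rewrite -fE.
rewrite monotone_convergence//; last 3 first.
- by move=> n; exact/measurable_EFinP.
- by move=> n x _; rewrite lee_fin.
- by move=> x _ m n mn; rewrite lee_fin; exact/lefP/nd_nnsfun_approx.
transitivity (limn (fun n => \int[mu]_x ((g x)%:E * (h n x)%:E))).
  congr (limn _); apply/funext => n.
  under eq_integral do rewrite fimfunE -fsumEFin//.
  under [RHS]eq_integral.
    move=> x _; rewrite fimfunE -fsumEFin// ge0_mule_fsumr; last first.
      by move=> y; rewrite nnfun_muleindic_ge0.
    over.
  have mi y : measurable_fun setT (fun x => (y * \1_(h n @^-1` [set y]) x)%:E).
    by apply/measurable_EFinP/measurable_funM.
  rewrite !ge0_integral_fsum//; last 3 first.
  - by move=> y; apply: emeasurable_funM.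
  - by move=> y x _; rewrite mule_ge0 ?lee_fin ?g0//; exact: nnfun_muleindic_ge0.
  - by move=> y x _; exact: nnfun_muleindic_ge0.
  apply: eq_fsbigr => y /[!inE] -[x _ yE].
  have y0 : (0 <= y)%R by rewrite -yE.
  under [RHS]eq_integral do rewrite EFinM muleCA.
  rewrite ge0_integralZl//=; last 2 first.
  - by apply: emeasurable_funM => //; apply/measurable_EFinP.
  - by move=> z _; rewrite mule_ge0// lee_fin.
  rewrite integralZl_indic_nnsfun// integral_indic// setIT mE//.
  rewrite /with_density integral_mkcond; congr (_ * _).
  apply: eq_integral => z _; rewrite patchE indicE.
  by case: ifP => _; rewrite ?mule1 ?mule0.
rewrite -monotone_convergence//; last 3 first.
- by move=> n; apply: emeasurable_funM => //; exact/measurable_EFinP.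
- by move=> n x _; rewrite mule_ge0// lee_fin.
- move=> x _ m n mn; apply: lee_wpmul2l; rewrite lee_fin//.
  by exact/lefP/nd_nnsfun_approx.
apply: eq_integral => x _; rewrite -fE.
apply/cvg_lim => //; apply: cvgeZl => //.
have := fcvg x; rewrite -fE; exact.
Qed.

End density.

(** * Dilations of the real line *)

Section scaling.
Context (R : realType).
Local Open Scope ereal_scope.
Local Notation mR := (measurableTypeR R).
Local Notation lambda := (@lebesgue_measure R).

(** Inversion is not continuous at 0, but on each open half-line it is a power
    function, up to sign. *)
Lemma measurable_invr : measurable_fun setT (@GRing.inv R).
Proof.
rewrite (_ : GRing.inv = fun x : R =>
    if (x < 0)%R then (- ((- x) `^ (-1)))%R else (x `^ (-1))%R); last first.
  apply/funext => x; case: ltP => x0.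
    by rewrite powR_inv1 ?invrN ?opprK// oppr_ge0 ltW.
  by rewrite powR_inv1.
apply: measurable_fun_ifT => //; first exact: measurable_fun_ltr.
apply: measurable_funN.
exact: (measurableT_comp (measurable_powR (-1))).
Qed.

(** The image of Lebesgue measure under x |-> c x, multiplied by c, gives every
    half-open interval its length, so it is Lebesgue measure. *)
Lemma ge0_integral_scale (c : R) (f : mR -> \bar R) : (0 < c)%R ->
  measurable_fun setT f -> (forall x, 0 <= f x) ->
  \int[lambda]_x f (c * x)%R = \int[lambda]_x ((c^-1)%:E * f x).
Proof.
move=> c0 mf f0.
have mc : measurable_fun setT (fun x : mR => (c * x)%R : mR).
  exact: measurable_funM.
have := ge0_integral_pushforward mc lambda measurableT mf.
rewrite preimage_setT => <-; last by move=> *; exact: f0.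
rewrite ge0_integralZl//; last by rewrite lee_fin invr_ge0 ltW.
have c0' : (0 <= c)%R by exact: ltW.
pose m := mscale (NngNum c0')
  (pushforward lambda (fun x : mR => (c * x)%R : mR)).
have mE A : measurable A -> lambda A = m mc A.
  apply: lebesgue_measure_unique => _ [[a b]] _ <-.
  rewrite /m/= /mscale/= /pushforward.
  rewrite (_ : _ @^-1` _ = `](c^-1 * a)%R, (c^-1 * b)%R]%classic); last first.
    apply/seteqP; split=> x/=; rewrite !in_itv/= ltr_pdivrMl// ler_pdivlMl//.
  rewrite !lebesgue_measure_itv/= !lte_fin ltr_pM2l ?invr_gt0//.
  case: ifPn => _; last by rewrite mule0.
  by rewrite -!EFinB -EFinM -mulrBr mulVKf// gt_eqF.
rewrite [in RHS](eq_measure_integral (m mc)); last by move=> A mA _; exact: mE.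
rewrite ge0_integral_mscale//= muleA -EFinM mulVf ?gt_eqF// mul1e//.
Qed.

End scaling.

(** * Normalized measures and almost sure identities *)

(** Stated as a product rather than a quotient, so as to cover the null measure,
    whose normalization is the default probability P. *)
Lemma ge0_integral_mnormalize d (T : measurableType d) (R : realType)
    (mu : {measure set T -> \bar R}) (P : probability T R) (f : T -> \bar R) :
  (mu setT < +oo)%E -> measurable_fun setT f -> (forall x, 0 <= f x)%E ->
  (\int[mu]_x f x = mu setT * \int[mnormalize mu P]_x f x)%E.
Proof.
move=> mufin mf f0.
have [mu0|mu0] := eqVneq (mu setT) 0%E.
  rewrite mu0 mul0e (eq_measure_integral mzero) ?integral_measure_zero//.
  by move=> A mA _; exact: (subset_measure0 mA measurableT).
have mu_fin : mu setT \is a fin_num by rewrite ge0_fin_numE.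
have c0 : 0 <= (fine (mu setT))^-1 by rewrite invr_ge0 fine_ge0.
rewrite [in RHS](eq_measure_integral (mscale (NngNum c0) mu)); last first.
  move=> A mA _; rewrite /= /mnormalize/= ifF; last first.
    by apply/negP => /orP[]/eqP h; [rewrite h eqxx in mu0|rewrite h in mufin].
  by rewrite /mscale/= muleC.
rewrite ge0_integral_mscale//= muleA.
suff -> : (mu setT * (fine (mu setT))^-1%:E = 1)%E by rewrite mul1e.
by rewrite -{1}(fineK mu_fin) -EFinM divff// fine_eq0.
Qed.

Lemma ae_measure_eq d (T : measurableType d) (R : realType)
    (mu : {measure set T -> \bar R}) (A B : set T) :
  measurable A -> measurable B -> {ae mu, forall x, A x <-> B x} ->
  mu A = mu B.
Proof.
move=> mA mB AB.
have ind E : measurable E -> mu E = (\int[mu]_x (\1_E x)%:E)%E.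
  by move=> mE; rewrite integral_indic// setIT.
rewrite !ind//; apply: ge0_ae_eq_integral => //.
- by apply/measurable_EFinP.
- by apply/measurable_EFinP.
apply: filterS AB => x AB _; rewrite !indicE; congr (_%:R%:E).
by congr nat_of_bool; apply/idP/idP; rewrite !inE => /AB.
Qed.

Lemma integral_probability_cst d (T : measurableType d) (R : realType)
  (P : probability T R) (c : \bar R) : (\int[P]_x c = c)%E.
Proof.
rewrite integral_cst// -[RHS]mule1; congr (_ * _)%E; exact: probability_setT.
Qed.

(** * Lebesgue-Stieltjes measure and the upper endpoint *)

Section upper_endpoint.
Context (R : realType) (F : cumulativeBounded (0 : R) (1 : R)).
Local Notation dF := (lebesgue_stieltjes_measure F).
Local Open Scope ereal_scope.

Lemma stieltjes_le (x : R) : dF `]-oo, x] = (F x)%:E.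
Proof.
have := cdf_lebesgue_stieltjes_id F x.
by rewrite /cdf /distribution /= /pushforward /= preimage_id.
Qed.

Lemma stieltjes_gt (x : R) : dF `]x, +oo[ = (1 - F x)%:E.
Proof.
rewrite -setCitvl probability_setC; last exact: measurable_itv.
by rewrite EFinB -stieltjes_le.
Qed.

(** When x_F is finite, right continuity forces F x_F = 1: a value below 1 at
    x_F would persist slightly to the right of x_F. The case x_F = -oo is
    excluded by the limit of F at -oo. *)
Lemma stieltjes_gt_upper_endpoint :
  dF [set r | upper_endpoint F < r%:E] = 0.
Proof.
case xFE : (upper_endpoint F) => [x| |].
- rewrite (_ : [set _ | _] = `]x, +oo[%classic); last by rewrite set_itvoy.
  have Fx : (1 <= F x)%R.
    rewrite leNgt; apply/negP => Fx1.
    have := @cumulative_is_right_continuous _ _ _ F x.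
    move=> /cvgr_lt/(_ _ Fx1) Fn.
    have : \forall y \near x^'+, (x < y)%R by exact: nbhs_right_gt.
    move=> xn; have [y [Fy xy]] := filter_ex (filterI Fn xn).
    have : y%:E <= upper_endpoint F by apply: ereal_sup_ubound; exists y.
    by rewrite xFE lee_fin leNgt xy.
  apply/eqP; rewrite -measure_le0 [X in X <= _]stieltjes_gt.
  by rewrite lee_fin subr_le0.
- by rewrite (_ : [set _ | _] = set0) ?measure0//; apply/seteqP; split.
- have := @cumulativeNy _ _ _ F => /cvgr_lt/(_ _ ltr01) Fn.
  have [y Fy] := filter_ex Fn.
  have : y%:E <= upper_endpoint F by apply: ereal_sup_ubound; exists y.
  by rewrite xFE leeNy_eq.
Qed.

End upper_endpoint.

Lemma law_stieltjes (R : realType) (F : cumulativeBounded (0 : R) (1 : R))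
    (P : probability (measurableTypeR R) R) :
  (forall x, P `]-oo, x]%classic = (F x)%:E) ->
  forall B, measurable B -> P B = lebesgue_stieltjes_measure F B.
Proof.
move=> PF B mB; apply/esym.
apply: lebesgue_stieltjes_measure_unique => // _ [[a b]] _ <-/=.
have [ab|ba] := leP a b; last first.
  by rewrite set_itv_ge ?measure0// bnd_simp -leNgt ltW.
have -> : `]a, b]%classic = `]-oo, b] `\` `]-oo, a] :> set (measurableTypeR R).
  by rewrite -[RHS]setCK setCD setCitvl setUC -[LHS]setCK setCitv.
have mD (Q : {finite_measure set (measurableTypeR R) -> \bar R}) :
    Q (`]-oo, b] `\` `]-oo, a]) = (Q `]-oo, b]%classic - Q `]-oo, a]%classic)%E.
  rewrite measureD ?setIidr//; first exact: subset_itvl.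
  by rewrite -ge0_fin_numE// fin_num_measure.
transitivity (lebesgue_stieltjes_measure F `]-oo, b]%classic
              - lebesgue_stieltjes_measure F `]-oo, a]%classic)%E.
  exact: mD.
apply/esym/(eq_trans (mD P)); congr (_ - _)%E.
  by apply: (eq_trans (PF b)); exact/esym/stieltjes_le.
by apply: (eq_trans (PF a)); exact/esym/stieltjes_le.
Qed.

(** * The curve t^p + z^p = r^p *)

Section powers.
Context (R : realType) (p : R) (p_gt0 : 0 < p).

(** The value of R W when R = r and R W_p = t. *)
Definition leg (t r : R) : R := (r `^ p - t `^ p) `^ p^-1.

Lemma powRKV (x : R) : 0 <= x -> (x `^ p) `^ p^-1 = x.
Proof. by move=> x0; rewrite -powRrM divff ?powRr1// gt_eqF. Qed.

Lemma powRVK (x : R) : 0 <= x -> (x `^ p^-1) `^ p = x.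
Proof. by move=> x0; rewrite -powRrM mulVf ?powRr1// gt_eqF. Qed.

Lemma lt_powR (x y : R) : 0 <= x -> 0 <= y -> (x `^ p < y `^ p) = (x < y).
Proof.
move=> x0 y0; apply/idP/idP => [|xy]; last by rewrite gt0_ltr_powR ?nnegrE.
by apply: contraTT; rewrite -!leNgt => yx; rewrite ge0_ler_powR ?nnegrE// ltW.
Qed.

Lemma lt_leg (t r z : R) : 0 <= t -> t < r -> 0 <= z ->
  (z < leg t r) = ((t `^ p + z `^ p) `^ p^-1 < r).
Proof.
move=> t0 tr z0; have r0 : 0 <= r by rewrite (le_trans t0)// ltW.
have d0 : 0 <= r `^ p - t `^ p by rewrite subr_ge0 ltW// lt_powR.
rewrite -lt_powR ?powR_ge0// powRVK// -[in RHS]lt_powR ?powR_ge0// powRVK.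
  by rewrite ltrBrDl.
by rewrite addr_ge0 ?powR_ge0.
Qed.

Lemma le_hypotenuse (t z : R) : 0 <= t -> t <= (t `^ p + z `^ p) `^ p^-1.
Proof.
move=> t0; rewrite -[leLHS]powRKV// ge0_ler_powR ?nnegrE ?powR_ge0//.
- by rewrite invr_ge0 ltW.
- by rewrite addr_ge0 ?powR_ge0.
- by rewrite lerDl powR_ge0.
Qed.

Lemma leg_weight (r w : R) : 0 < r -> 0 <= w <= 1 ->
  leg (r * w) r = r * (1 - w `^ p) `^ p^-1.
Proof.
move=> r0 /andP[w0 w1]; rewrite /leg powRM ?(ltW r0)//.
rewrite -{1}[r `^ p]mulr1 -mulrBr powRM ?powR_ge0 ?powRKV ?(ltW r0)//.
rewrite subr_ge0 -[leRHS](congr1 (@^~ p) (powR1 R)) ge0_ler_powR ?nnegrE//.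
exact: ltW.
Qed.

End powers.
Lemma measurable_leg (R : realType) (p : R) :
  measurable_fun setT
    (fun z : measurableTypeR R * measurableTypeR R => leg p z.1 z.2).
Proof.
apply: (measurableT_comp (measurable_powR p^-1)).
apply: measurable_funB.
  by apply: (measurableT_comp (measurable_powR p)); exact: measurable_snd.
by apply: (measurableT_comp (measurable_powR p)); exact: measurable_fst.
Qed.

(** The map w |-> (1 - w^p)^(1/p) is an involution of [0, 1], so W determines
    W_p. *)
Lemma compl_weightK (R : realType) (p w : R) : 0 < p -> 0 <= w <= 1 ->
  (1 - ((1 - w `^ p) `^ p^-1) `^ p) `^ p^-1 = w.
Proof.
move=> p0 /andP[w0 w1]; rewrite powRVK//.
  by rewrite opprB addrCA subrr addr0 powRKV.
rewrite subr_ge0 -[leRHS](congr1 (@^~ p) (powR1 R)) ge0_ler_powR ?nnegrE//.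
exact: ltW.
Qed.

(** * The radius R given the value of R W_p *)

Section radial.
Context (R : realType) (F : cumulativeBounded (0 : R) (1 : R)) (g : R -> R).
Local Notation mR := (measurableTypeR R).
Local Notation lambda := (@lebesgue_measure R).
Local Notation dF := (lebesgue_stieltjes_measure F).
Local Open Scope ereal_scope.

(** The joint density of (R W_p, R) with respect to dt dF(r). Extending g by 0
    outside ]0, 1[ makes it vanish unless 0 < t < r. *)
Definition radial_density (t r : mR) : R :=
  if (0 < r)%R then ((g \_ `]0%R, 1%R[) (t / r) / r)%R else 0%R.

Definition positive_density :=
  @measurable_fun _ _ mR R `]0%R, 1%R[ g /\ forall x, (0 < x < 1 -> 0 < g x)%R.

Hypothesis g_pos : positive_density.

Lemma measurable_g : @measurable_fun _ _ mR R setT (g \_ `]0%R, 1%R[).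
Proof.
apply/(measurable_restrictT _ _).1 => //; exact: g_pos.1.
Qed.

Lemma g_restrict_ge0 x : (0 <= (g \_ `]0%R, 1%R[) x)%R.
Proof.
rewrite patchE; case: ifPn => // /set_mem/=; rewrite in_itv/= => x01.
by rewrite ltW// g_pos.2.
Qed.

Lemma radial_density_ge0 t r : (0 <= radial_density t r)%R.
Proof.
rewrite /radial_density; case: ifPn => // r0.
by rewrite divr_ge0 ?g_restrict_ge0// ltW.
Qed.

Lemma measurable_radial_density2 :
  measurable_fun setT (fun z : mR * mR => radial_density z.1 z.2).
Proof.
have mV : measurable_fun setT (fun z : mR * mR => z.2^-1%R : mR).
  exact: (measurableT_comp (@measurable_invr R) measurable_snd).
apply: measurable_fun_ifT => //.
  by apply: measurable_fun_ltr => //; exact: measurable_snd.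
apply: measurable_funM => //.
apply: (measurableT_comp measurable_g).
by apply: measurable_funM => //; exact: measurable_fst.
Qed.

Lemma measurable_radial_density t : measurable_fun setT (radial_density t).
Proof.
have := measurableT_comp measurable_radial_density2 (measurable_pair1 t).
exact.
Qed.

Definition radial_kernel (t : mR) : {measure set mR -> \bar R} :=
  with_density dF (measurable_radial_density t) (radial_density_ge0 t).

Lemma measurable_radial_kernel (B : set mR) : measurable B ->
  measurable_fun setT (radial_kernel ^~ B).
Proof.
move=> mB.
rewrite (_ : radial_kernel ^~ B = fubini_F dF (fun z : mR * mR =>
    ((radial_density z.1 z.2)%:E * (\1_B z.2)%:E))); last first.
  apply/funext => t; rewrite /radial_kernel/= /with_density integral_mkcond.
  rewrite /fubini_F; apply: eq_integral => r _; rewrite patchE indicE/=.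
  by case: ifP; rewrite ?mule1 ?mule0.
apply: measurable_fun_fubini_tonelli_F => /=.
  apply: emeasurable_funM; apply/measurable_EFinP.
    exact: measurable_radial_density2.
  by apply: measurableT_comp => //; exact: measurable_snd.
by move=> z; rewrite mule_ge0// lee_fin ?radial_density_ge0.
Qed.

HB.instance Definition _ :=
  isKernel.Build _ _ _ _ _ radial_kernel measurable_radial_kernel.

(** The law of R given R W_p = t. The default law dF is used at those t where
    the density of R W_p is 0 or infinite, a set that R W_p avoids almost
    surely. *)
Definition radial_law : mR -> {measure set mR -> \bar R} :=
  knormalize radial_kernel dF.

HB.instance Definition _ := ProbabilityKernel.on radial_law.

Lemma integral_radial_kernel t (f : mR -> \bar R) :
  measurable_fun setT f -> (forall r, 0 <= f r) ->
  \int[radial_kernel t]_r f r = \int[dF]_r ((radial_density t r)%:E * f r).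
Proof.
move=> mf f0; apply: (ge0_integral_density (mg := measurable_radial_density t)
  (g0 := radial_density_ge0 t)) => //.
Qed.

Lemma measurable_integral_radial_kernel (H : mR * mR -> \bar R) :
  measurable_fun setT H -> (forall z, 0 <= H z) ->
  measurable_fun setT (fun t => \int[radial_kernel t]_r H (t, r)).
Proof.
move=> mH H0.
rewrite (_ : (fun _ => _) = fubini_F dF (fun z : mR * mR =>
    (radial_density z.1 z.2)%:E * H z)); last first.
  apply/funext => t; rewrite integral_radial_kernel//.
  exact: (measurableT_comp mH (measurable_pair1 t)).
apply: measurable_fun_fubini_tonelli_F.
  apply: emeasurable_funM => //; apply/measurable_EFinP.
  exact: measurable_radial_density2.
by move=> z; rewrite mule_ge0// lee_fin radial_density_ge0.
Qed.

Variable muW : probability mR R.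
Hypothesis muWE : forall B, measurable B ->
  muW B = \int[lambda]_(x in B `&` `]0%R, 1%R[) (g x)%:E.
Hypothesis dF0 : dF [set r | (r <= 0)%R] = 0.

(** Substitute t = r w in the inner integral, which needs r > 0, then exchange
    the two integrals. *)
Lemma integral_radial (H : mR * mR -> \bar R) :
  measurable_fun setT H -> (forall z, 0 <= H z) ->
  \int[dF]_r \int[muW]_w H ((r * w)%R, r) =
  \int[lambda]_t \int[radial_kernel t]_r H (t, r).
Proof.
move=> mH H0.
have mrt : measurable_fun setT (fun z : mR * mR => ((z.1 * z.2)%R : mR, z.1)).
  apply/measurable_fun_pairP; split; last exact: measurable_fst.
  by apply: measurable_funM; [exact: measurable_fst|exact: measurable_snd].
pose K (z : mR * mR) := (radial_density z.2 z.1)%:E * H (z.2, z.1).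
have msw : measurable_fun setT (fun z : mR * mR => (z.2, z.1)).
  apply/measurable_fun_pairP; split; first exact: measurable_snd.
  exact: measurable_fst.
have mK : measurable_fun setT K.
  apply: emeasurable_funM; last exact: (measurableT_comp mH msw).
  apply/measurable_EFinP.
  exact: (measurableT_comp measurable_radial_density2 msw).
have K0 z : 0 <= K z by rewrite mule_ge0// lee_fin radial_density_ge0.
transitivity (\int[dF]_r \int[lambda]_t K (r, t)).
  apply: ge0_ae_eq_integral => //.
  - apply: (measurable_fun_fubini_tonelli_F
      (fun z : mR * mR => H ((z.1 * z.2)%R, z.1))) => //.
    exact: (measurableT_comp mH mrt).
  - exact: (measurable_fun_fubini_tonelli_F K).
  - by move=> r _; exact: integral_ge0.
  - by move=> r _; exact: integral_ge0.
  exists [set r | (r <= 0)%R]; split => //.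
    by rewrite -set_itvNyc; exact: measurable_itv.
  move=> r/=; apply: contra_notP => /negP; rewrite -ltNge => r0 _.
  have mHr : measurable_fun setT (fun w : mR => H ((r * w)%R, r)).
    exact: (measurableT_comp (measurableT_comp mH mrt) (measurable_pair1 r)).
  rewrite (ge0_integral_density (mu := lambda) (mg := measurable_g)
    (g0 := g_restrict_ge0))//; last first.
    move=> B mB; apply: (eq_trans (muWE mB)).
    rewrite /with_density integral_mkcondr.
    by apply: eq_integral => x _; rewrite !patchE; case: ifP.
  pose phi (t : mR) := ((g \_ `]0%R, 1%R[) (t / r))%:E * H (t, r).
  transitivity (\int[lambda]_w phi (r * w)%R).
    by apply: eq_integral => w _; rewrite /phi mulrAC divff ?mul1r// gt_eqF.
  rewrite ge0_integral_scale//.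
  - apply: eq_integral => t _.
    by rewrite /phi muleA -EFinM /K /radial_density r0 [X in X%:E]mulrC.
  - apply: emeasurable_funM.
      apply/measurable_EFinP; apply: (measurableT_comp measurable_g).
      exact: measurable_funM.
    exact: (measurableT_comp mH (measurable_pair2 r)).
  - by move=> x; rewrite /phi mule_ge0// lee_fin g_restrict_ge0.
transitivity (\int[lambda]_t \int[dF]_r K (r, t)).
  exact: (fubini_tonelli K mK K0).
apply: eq_integral => t _; rewrite integral_radial_kernel//.
exact: (measurableT_comp mH (measurable_pair1 t)).
Qed.

(** The mass of [radial_kernel t] is the density of R W_p at t, and a density
    has integral 1. *)
Lemma radial_kernel_fin : {ae lambda, forall t, radial_kernel t setT < +oo}.
Proof.
have intf : \int[lambda]_t radial_kernel t setT = 1.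
  transitivity (\int[lambda]_t \int[radial_kernel t]_r (cst 1 (t, r))).
    by apply: eq_integral => t _; rewrite integral_cst// mul1e.
  rewrite -(@integral_radial (cst 1))//.
  under eq_integral do rewrite integral_cst// mul1e.
  rewrite integral_cst// probability_setT mul1e.
  exact: probability_setT.
have : lambda.-integrable setT (fun t => radial_kernel t setT).
  apply/integrableP; split; first exact: measurable_radial_kernel.
  under eq_integral do rewrite gee0_abs//.
  by rewrite intf ltry.
move=> /integrable_ae -/(_ measurableT); apply: filterS => t /(_ I).
by rewrite ge0_fin_numE.
Qed.

(** By [integral_radial], both sides integrate over t against the unnormalized
    kernel: the left one integrates H (t, _), the right one the constant equal
    to the mean of H (t, _). These integrals agree when the mass is finite. *)
Lemma integral_radial_law (H : mR * mR -> \bar R) :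
  measurable_fun setT H -> (forall z, 0 <= H z) ->
  \int[dF]_r \int[muW]_w H ((r * w)%R, r) =
  \int[dF]_r \int[muW]_w \int[radial_law (r * w)%R]_s H ((r * w)%R, s).
Proof.
move=> mH H0.
pose H' (z : mR * mR) := \int[radial_law z.1]_s H (z.1, s).
have mH'1 : measurable_fun setT (fun t => \int[radial_law t]_s H (t, s)).
  exact: (measurable_fun_integral_sfinite_kernel H radial_law).
have mH' : measurable_fun setT H'.
  exact: (measurableT_comp mH'1 measurable_fst).
have H'0 z : 0 <= H' z by exact: integral_ge0.
have mHt t : measurable_fun setT (fun s => H (t, s)).
  exact: (measurableT_comp mH (measurable_pair1 t)).
apply: (eq_trans (integral_radial mH H0)).
apply: (eq_trans _ (esym (integral_radial mH' H'0))).
apply: ge0_ae_eq_integral => //.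
- exact: measurable_integral_radial_kernel.
- exact: measurable_integral_radial_kernel.
- by move=> t _; exact: integral_ge0.
- by move=> t _; exact: integral_ge0.
apply: filterS radial_kernel_fin => t tfin _.
rewrite (@ge0_integral_mnormalize _ _ _ _ dF)//.
by rewrite /H'/= integral_cst//= muleC.
Qed.

Definition radial_finite := [set t | radial_kernel t setT < +oo].

Lemma measurable_radial_finite : measurable radial_finite.
Proof.
rewrite -[X in measurable X]setTI.
apply: emeasurable_fun_infty_o => //; exact: measurable_radial_kernel.
Qed.

Lemma radial_finite_ae :
  \int[dF]_r \int[muW]_w (\1_(~` radial_finite) (r * w)%R)%:E = 0.
Proof.
pose H (z : mR * mR) := (\1_(~` radial_finite) z.1 : R)%:E.
have mC : measurable (~` radial_finite).
  by apply: measurableC; exact: measurable_radial_finite.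
have mH : measurable_fun setT H.
  apply/measurable_EFinP.
  exact: (measurableT_comp (measurable_indic mC) measurable_fst).
have H0 z : 0 <= H z by rewrite lee_fin.
rewrite (integral_radial mH H0).
transitivity (\int[lambda]_t (cst 0 t)); last by rewrite integral0.
apply: ge0_ae_eq_integral => //.
- exact: measurable_integral_radial_kernel.
- by move=> t _; exact: integral_ge0.
apply: filterS radial_kernel_fin => t tfin _.
rewrite /H/= integral_cst// indicE memNset ?mul0e//.
Qed.

End radial.

(** * The distribution function Q *)

Section radial_law_cdf.
Context (R : realType) (F : cumulativeBounded (0 : R) (1 : R)) (g : R -> R).
Hypothesis g_pos : positive_density g.
Local Notation mR := (measurableTypeR R).
Local Notation dF := (lebesgue_stieltjes_measure F).
Local Notation k := (radial_kernel F g_pos).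
Local Open Scope ereal_scope.
Variables (t : R) (t_gt0 : (0 < t)%R).

Lemma radial_densityE (r : R) : (t < r)%R ->
  radial_density g t r = (g (t / r) / r)%R.
Proof.
move=> tr; have r0 : (0 < r)%R by exact: lt_trans tr.
rewrite /radial_density r0 patchE ifT// inE/= in_itv/=.
by rewrite divr_gt0//= ltr_pdivrMr// mul1r.
Qed.

Lemma radial_density_le (r : R) : (r <= t)%R -> radial_density g t r = 0%R.
Proof.
move=> rt; rewrite /radial_density; case: ifPn => // r0.
rewrite patchE ifF ?mul0r//; apply/negP; rewrite inE/= in_itv/=.
by rewrite ltr_pdivrMr// mul1r => /andP[_]; rewrite ltNge rt.
Qed.

Lemma radial_kernel_support (B : set mR) : k t B = k t (B `&` `]t, +oo[).
Proof.
rewrite /radial_kernel/= /with_density [LHS]integral_mkcond [RHS]integral_mkcond.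
apply: eq_integral => r _; rewrite !patchE in_setI.
case: (r \in B) => //=; case: ifPn => //.
rewrite notin_setE/= in_itv/= andbT => /negP; rewrite -leNgt => rt.
by rewrite radial_density_le.
Qed.

Lemma measurable_gt_upper_endpoint :
  measurable ([set r | upper_endpoint F < r%:E] : set mR).
Proof.
rewrite -[X in measurable X]setTI.
by apply: emeasurable_fun_o_infty => //; exact/measurable_EFinP.
Qed.

Lemma radial_domE (s : R) : radial_dom F s =
  `]s, +oo[%classic `\` [set r | upper_endpoint F < r%:E] :> set mR.
Proof.
apply/seteqP; split => r/=; rewrite /radial_dom/= in_itv/= andbT.
  by move=> [-> /le_gtF ->].
by move=> [-> /negP]; rewrite -leNgt.
Qed.

(** The measure dF does not charge the half-line beyond x_F, so integrals up to
    x_F and up to +oo agree. *)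
Lemma radial_kernel_gt (s : R) : (t <= s)%R ->
  k t (`]s, +oo[%classic : set mR) =
  \int[dF]_(r in radial_dom F s) (g (t / r) / r)%:E.
Proof.
move=> ts; rewrite /radial_kernel/= /with_density.
rewrite (ge0_negligible_integral measurable_gt_upper_endpoint)//.
- rewrite -radial_domE; apply: eq_integral => r; rewrite inE => -[/= sr _].
  by rewrite radial_densityE// (le_lt_trans ts).
- apply: measurable_funTS; apply/measurable_EFinP.
  exact: measurable_radial_density.
- by move=> r _; rewrite lee_fin radial_density_ge0.
- exact: stieltjes_gt_upper_endpoint.
Qed.

Lemma radial_integrableE :
  radial_integrable F g t <-> k t setT < +oo.
Proof.
rewrite radial_kernel_support setTI radial_kernel_gt// /radial_integrable.
have -> : \int[dF]_(r in radial_dom F t) (g (t / r) / r)%:E =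
    \int[dF]_(r in radial_dom F t) `|(g (t / r) / r)%:E|.
  apply: eq_integral => r; rewrite inE => -[/= tr _].
  by rewrite /= ger0_norm// -radial_densityE// radial_density_ge0.
split=> [/integrableP[]//|fin]; apply/integrableP; split => //.
apply/measurable_EFinP.
apply: (@eq_measurable_fun _ _ mR R _ (radial_density g t)).
  by move=> r; rewrite inE => -[/= tr _]; rewrite radial_densityE.
by apply: measurable_funTS; exact: measurable_radial_density.
Qed.

Lemma radial_integralE (s : R) : (t <= s)%R ->
  radial_integral F g t s = fine (k t (`]s, +oo[%classic : set mR)).
Proof. by move=> ts; rewrite radial_kernel_gt. Qed.

(** The integrand is positive on ]t, +oo[, which has dF-measure 1 - F t. *)
Lemma radial_kernel_gt0 : (F t < 1)%R -> 0 < k t setT.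
Proof.
move=> Ft; rewrite lt0e measure_ge0 andbT.
apply/eqP => k0.
have : ae_eq dF (`]t, +oo[%classic : set mR) (EFin \o radial_density g t) (cst 0).
  apply/ae_eq_integral_abs.
  - exact: measurable_itv.
  - apply: measurable_funTS; apply/measurable_EFinP.
    exact: measurable_radial_density.
  rewrite radial_kernel_support setTI in k0; rewrite -[RHS]k0.
  by apply: eq_integral => r _; rewrite /= ger0_norm// radial_density_ge0.
move=> [N [mN N0 tN]].
have : dF (`]t, +oo[%classic : set mR) = 0.
  apply: (subset_measure0 _ mN _ N0); first exact: measurable_itv.
  move=> r/= tr; apply: tN => /= /(_ tr)/eqP; apply/negP.
  move: tr; rewrite /= in_itv/= andbT => tr.
  have r0 : (0 < r)%R by exact: lt_trans tr.
  rewrite eqe radial_densityE// mulf_neq0// ?invr_eq0 gt_eqF// g_pos.2//.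
  by rewrite divr_gt0//= ltr_pdivrMr// mul1r.
by apply/eqP; rewrite [X in X == _]stieltjes_gt gt_eqF// lte_fin subr_gt0.
Qed.

Hypotheses (Ft : (F t < 1)%R) (fint : radial_integrable F g t).

Lemma radial_lawE (B : set mR) :
  radial_law F g_pos t B = k t B * (fine (k t setT))^-1%:E.
Proof.
rewrite /radial_law /knormalize /= /mnormalize ifF//.
apply/negP => /orP[]/eqP h.
  by have := radial_kernel_gt0 Ft; rewrite h ltxx.
by have /radial_integrableE := fint; rewrite h ltxx.
Qed.

Lemma radial_law_gt : radial_law F g_pos t (`]t, +oo[%classic : set mR) = 1.
Proof.
rewrite radial_lawE -{1}[`]t, +oo[%classic]setTI -radial_kernel_support.
rewrite -radial_lawE.
exact: prob_kernel.
Qed.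

Lemma measurable_leg1 p : measurable_fun setT (fun r : mR => leg p t r).
Proof.
have := measurableT_comp (measurable_leg p) (measurable_pair1 (t : mR)).
exact.
Qed.

(** For r > t, the leg exceeds z exactly when r exceeds (t^p + z^p)^(1/p); so the
    tail of the law of the leg is a ratio of masses of half-lines. *)
Lemma cdf_radial_law (p z : R) : (0 < p)%R ->
  radial_law F g_pos t [set r | (leg p t r <= z)%R] = (Qdf p F g t z)%:E.
Proof.
move=> p0; rewrite /Qdf.
have mleg : measurable ([set r | (z < leg p t r)%R] : set mR).
  have := measurable_leg1 p measurableT (measurable_itv `]z, +oo[).
  by rewrite setTI set_itvoy.
have -> : [set r | (leg p t r <= z)%R] = ~` [set r | (z < leg p t r)%R] :> set mR.
  by apply/seteqP; split => r /=; rewrite leNgt => /negP.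
have -> : radial_law F g_pos t (~` [set r | (z < leg p t r)%R]) =
    1 - radial_law F g_pos t [set r | (z < leg p t r)%R].
  exact: probability_setC.
have t0 := ltW t_gt0.
case: ifPn => z0; last first.
  rewrite radial_lawE radial_kernel_support.
  (* The leg is positive on the whole support, so Q vanishes at z <= 0. *)
  rewrite (_ : _ `&` _ = `]t, +oo[%classic); last first.
    apply/setIidr => r/=; rewrite in_itv/= andbT => tr.
    rewrite (@le_lt_trans _ _ 0%R) ?leNgt// lt_leg// powR0 ?gt_eqF// addr0.
    by rewrite powRKV.
  by rewrite -radial_lawE radial_law_gt subee.
rewrite EFinB; congr (_ - _).
rewrite radial_lawE radial_kernel_support.
set s := ((t `^ p + z `^ p) `^ p^-1)%R.
have ts : (t <= s)%R by exact: le_hypotenuse.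
rewrite (_ : _ `&` _ = `]s, +oo[%classic); last first.
  apply/seteqP; split => r/=; rewrite !in_itv/= !andbT.
    by move=> [zr tr]; rewrite -lt_leg// ltW.
  by move=> sr; have tr := le_lt_trans ts sr; rewrite lt_leg ?(ltW z0).
have kT : k t (`]t, +oo[%classic : set mR) = k t setT.
  by rewrite [RHS]radial_kernel_support setTI.
rewrite !radial_integralE// kT EFinM fineK//.
rewrite ge0_fin_numE ?measure_ge0//; apply: (@le_lt_trans _ _ (k t setT)).
  by apply: le_measure; rewrite ?inE//; exact: measurable_itv.
exact/radial_integrableE.
Qed.

End radial_law_cdf.

(** * Product laws from independence *)

Section independence.
Local Open Scope ereal_scope.
Context d (T : measurableType d) (R : realType) (P : probability T R).

(** Keeping an extra event D makes it possible to merge independent variables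
    one pair at a time. Dividing by P D reduces the claim to the uniqueness of
    product measures. *)
Lemma product_law_on d1 d2 (T1 : measurableType d1) (T2 : measurableType d2)
    (X1 : T -> T1) (X2 : T -> T2) (m1 : probability T1 R)
    (m2 : probability T2 R) (D : set T) :
  measurable_fun setT X1 -> measurable_fun setT X2 -> measurable D ->
  (forall A1 A2, measurable A1 -> measurable A2 ->
     P (D `&` (X1 @^-1` A1 `&` X2 @^-1` A2)) = P D * (m1 A1 * m2 A2)) ->
  forall E, measurable E ->
    P (D `&` (fun w => (X1 w, X2 w)) @^-1` E) = P D * (m1 \x m2) E.
Proof.
move=> mX1 mX2 mD X12 E mE.
have mX : measurable_fun setT (fun w => (X1 w, X2 w)).
  exact/measurable_fun_pairP.
have mXE : measurable ((fun w => (X1 w, X2 w)) @^-1` E).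
  by rewrite -[X in measurable X]setTI; exact: mX.
have [PD0|PD0] := eqVneq (P D) 0.
  rewrite PD0 mul0e; apply: subset_measure0 PD0 => //.
  exact: measurableI.
have PDfin : P D \is a fin_num by exact: fin_num_measure.
have c0 : (0 <= (fine (P D))^-1)%R by rewrite invr_ge0 fine_ge0.
have PDK x : P D * ((fine (P D))^-1%:E * x) = x.
  by rewrite muleA -{1}(fineK PDfin) -EFinM divff ?mul1e// fine_eq0.
pose m := mscale (NngNum c0) (pushforward (mrestr P mD) (fun w => (X1 w, X2 w))).
have -> : (m1 \x m2) E = m mX E.
  apply: product_measure_unique => // A1 A2 mA1 mA2.
  rewrite /m/= /mscale/= /pushforward/= /mrestr/= setIC.
  by rewrite (X12 _ _ mA1 mA2) muleCA PDK.
by rewrite /m/= /mscale/= /pushforward/= /mrestr/= PDK setIC.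
Qed.

Lemma ge0_integral_product_law d1 d2 (T1 : measurableType d1)
    (T2 : measurableType d2) (X1 : T -> T1) (X2 : T -> T2)
    (m1 : probability T1 R) (m2 : probability T2 R)
    (f : T1 * T2 -> \bar R) :
  measurable_fun setT X1 -> measurable_fun setT X2 ->
  (forall A1 A2, measurable A1 -> measurable A2 ->
     P (X1 @^-1` A1 `&` X2 @^-1` A2) = m1 A1 * m2 A2) ->
  measurable_fun setT f -> (forall z, 0 <= f z) ->
  \int[P]_w f (X1 w, X2 w) = \int[m1]_x \int[m2]_y f (x, y).
Proof.
move=> mX1 mX2 X12 mf f0.
have mX : measurable_fun setT (fun w => (X1 w, X2 w)).
  exact/measurable_fun_pairP.
rewrite -(fubini_tonelli1 f)//.
have := ge0_integral_pushforward mX P measurableT mf.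
rewrite preimage_setT => <-; last by move=> *; exact: f0.
apply: eq_measure_integral => E mE _.
have := product_law_on (m1 := m1) (m2 := m2) mX1 mX2 measurableT.
rewrite probability_setT => /(_ _ _ mE); rewrite setTI mul1e; apply.
by move=> A1 A2 mA1 mA2; rewrite setTI mul1e X12.
Qed.

Context d1 d2 d3 d4 (T1 : measurableType d1) (T2 : measurableType d2)
  (T3 : measurableType d3) (T4 : measurableType d4).
Variables (X1 : T -> T1) (X2 : T -> T2) (X3 : T -> T3) (X4 : T -> T4).
Hypotheses (mX1 : measurable_fun setT X1) (mX2 : measurable_fun setT X2)
  (mX3 : measurable_fun setT X3) (mX4 : measurable_fun setT X4).
Variables (m1 : probability T1 R) (m2 : probability T2 R)
  (m3 : probability T3 R) (m4 : probability T4 R).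
Hypothesis X1234 : forall A1 A2 A3 A4,
  measurable A1 -> measurable A2 -> measurable A3 -> measurable A4 ->
  P (X1 @^-1` A1 `&` (X2 @^-1` A2 `&` (X3 @^-1` A3 `&` X4 @^-1` A4))) =
  m1 A1 * (m2 A2 * (m3 A3 * m4 A4)).

Let mpre d' (T' : measurableType d') (X : T -> T') A :
  measurable_fun setT X -> measurable A -> measurable (X @^-1` A).
Proof. by move=> mX mA; rewrite -[X in measurable X]setTI; exact: mX. Qed.

Lemma ge0_integral_independent4 (f : T1 * (T2 * (T3 * T4)) -> \bar R) :
  measurable_fun setT f -> (forall z, 0 <= f z) ->
  \int[P]_w f (X1 w, (X2 w, (X3 w, X4 w))) =
  \int[m1]_x1 \int[m2]_x2 \int[m3]_x3 \int[m4]_x4 f (x1, (x2, (x3, x4))).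
Proof.
move=> mf f0.
have mX34 : measurable_fun setT (fun w => (X3 w, X4 w)).
  exact/measurable_fun_pairP.
have mX234 : measurable_fun setT (fun w => (X2 w, (X3 w, X4 w))).
  exact/measurable_fun_pairP.
have P12 A1 A2 : measurable A1 -> measurable A2 ->
    P (X1 @^-1` A1 `&` X2 @^-1` A2) = m1 A1 * m2 A2.
  move=> mA1 mA2; have := X1234 mA1 mA2 measurableT measurableT.
  by rewrite !preimage_setT !setIT !probability_setT !mule1.
have P1 A1 : measurable A1 -> P (X1 @^-1` A1) = m1 A1.
  move=> mA1; have := P12 _ _ mA1 measurableT.
  by rewrite preimage_setT setIT probability_setT mule1.
have X34 A1 A2 E : measurable A1 -> measurable A2 -> measurable E ->
    P (X1 @^-1` A1 `&` X2 @^-1` A2 `&` (fun w => (X3 w, X4 w)) @^-1` E) =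
    m1 A1 * m2 A2 * (m3 \x m4) E.
  move=> mA1 mA2 mE; rewrite -P12//; apply: product_law_on => //.
    by apply: measurableI; exact: mpre.
  by move=> A3 A4 mA3 mA4; rewrite -setIA X1234// P12// muleA.
have X234 A1 E : measurable A1 -> measurable E ->
    P (X1 @^-1` A1 `&` (fun w => (X2 w, (X3 w, X4 w))) @^-1` E) =
    m1 A1 * (m2 \x (m3 \x m4)) E.
  move=> mA1 mE; rewrite -P1//; apply: product_law_on => //.
    exact: mpre.
  by move=> A2 A3 mA2 mA3; rewrite setIA X34// P1// muleA.
rewrite (ge0_integral_product_law (m1 := m1)
  (m2 := m2 \x (m3 \x m4)) mX1 mX234 _ mf f0)//.
apply: eq_integral => x1 _.
have mf1 : measurable_fun setT (fun z => f (x1, z)).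
  exact: (measurableT_comp mf (measurable_pair1 x1)).
rewrite (fubini_tonelli1 (fun z => f (x1, z)))//.
apply: eq_integral => x2 _; rewrite /fubini_F.
have mf2 : measurable_fun setT (fun z => f (x1, (x2, z))).
  exact: (measurableT_comp mf1 (measurable_pair1 x2)).
by rewrite (fubini_tonelli1 (fun z => f (x1, (x2, z)))).
Qed.

End independence.

Section mutual_independence.
Context d (T : measurableType d) (R : realType) (P : probability T R).
Local Open Scope ereal_scope.

Lemma mutually_independent4 (S1 S2 S3 S4 : set_system T) :
  mutually_independent P [:: S1; S2; S3; S4] ->
  forall E1 E2 E3 E4, S1 E1 -> S2 E2 -> S3 E3 -> S4 E4 ->
  P (E1 `&` (E2 `&` (E3 `&` E4))) = P E1 * (P E2 * (P E3 * P E4)).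
Proof.
move=> ind E1 E2 E3 E4 SE1 SE2 SE3 SE4.
have := ind [set: 'I_4]%SET (fun i => nth set0 [:: E1; E2; E3; E4] i).
under eq_bigl do rewrite finset.in_setT.
rewrite !big_ord_recl big_ord0/= mule1 => <-.
  congr (P _); apply/seteqP; split => [x [? [? [? ?]]] [[|[|[|[|]]]]]//|x h].
  have {}h (i : 'I_4) : nth set0 [:: E1; E2; E3; E4] i x.
    by apply: h => /=; rewrite finset.in_setT.
  split; first exact: (h (@Ordinal 4 0 isT)).
  split; first exact: (h (@Ordinal 4 1 isT)).
  split; first exact: (h (@Ordinal 4 2 isT)).
  exact: (h (@Ordinal 4 3 isT)).
by move=> [[|[|[|[|]]]]].
Qed.

(** Replacing E i by the full space for i outside K turns every subfamily into
    the full one. *)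
Lemma mutually_independent2 (S1 S2 : set_system T) :
  S1 setT -> S2 setT ->
  (forall E1 E2, S1 E1 -> S2 E2 -> P (E1 `&` E2) = P E1 * P E2) ->
  mutually_independent P [:: S1; S2].
Proof.
move=> S1T S2T ind K E KE.
pose E' i := if i \in K then E i else setT.
have -> : \bigcap_(i in [set` K]) E i =
    E' (@Ordinal 2 0 isT) `&` E' (@Ordinal 2 1 isT).
  apply/seteqP; split => [x h|x [h0 h1] [[|[|]]//= i2] iK].
  - by split; rewrite /E'; case: ifPn => // iK; exact: h.
  - have e : Ordinal i2 = @Ordinal 2 0 isT by exact: val_inj.
    by rewrite /= e in iK *; move: h0; rewrite /E' iK.
  - have e : Ordinal i2 = @Ordinal 2 1 isT by exact: val_inj.
    by rewrite /= e in iK *; move: h1; rewrite /E' iK.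
rewrite ind//; last 2 first.
- by rewrite /E'; case: ifPn => // /KE.
- by rewrite /E'; case: ifPn => // /KE.
have PE' i : P (E' i) = if i \in K then P (E i) else 1.
  by rewrite /E'; case: ifP => // _; exact: probability_setT.
rewrite big_mkcond/=; under eq_bigr do rewrite -PE'.
rewrite !big_ord_recl big_ord0/= mule1.
by congr (P (E' _) * P (E' _)); exact: val_inj.
Qed.

End mutual_independence.

(** * Subvectors and norms *)

Lemma subvec_mulmx (R : realType) n (K I : {set 'I_n}) (A : 'M[R]_n) x :
  subvec K (A *m x) = submat K I A *m subvec I x
                      + submat K (~: I) A *m subvec (~: I) x.
Proof.
apply/matrixP => i j; rewrite !mxE (bigID (mem I))/=; congr (_ + _).
  by rewrite big_enum_val; apply: eq_bigr => k _; rewrite !mxE.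
under eq_bigl do rewrite -finset.in_setC.
by rewrite big_enum_val; apply: eq_bigr => k _; rewrite !mxE.
Qed.

Section vector_functions.
Context (R : realType).

Lemma measurable_mulmx m n (A : 'M[R]_(m, n)) :
  measurable_fun setT (fun x : 'cV[R]_n => A *m x).
Proof.
apply: measurable_fun_matrix => i j; under eq_fun do rewrite mxE.
apply: measurable_sum => k; apply: measurable_funM => //.
exact: measurable_entry.
Qed.

Lemma measurable_subvec n (K : {set 'I_n}) :
  measurable_fun setT (@subvec R n K).
Proof.
apply: measurable_fun_matrix => i j; under eq_fun do rewrite mxE.
exact: measurable_entry.
Qed.

Context d (T : measurableType d) (n : nat).

Lemma measurable_addmx (f h : T -> 'cV[R]_n) :
  measurable_fun setT f -> measurable_fun setT h ->
  measurable_fun setT (fun x => f x + h x).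
Proof.
move=> mf mh; apply: measurable_fun_matrix => i j.
under eq_fun do rewrite mxE.
by apply: measurable_funD; apply: (measurableT_comp (measurable_entry i j)).
Qed.

Lemma measurable_scalemx (c : T -> R) (f : T -> 'cV[R]_n) :
  measurable_fun setT c -> measurable_fun setT f ->
  measurable_fun setT (fun x => c x *: f x).
Proof.
move=> mc mf; apply: measurable_fun_matrix => i j.
under eq_fun do rewrite mxE.
by apply: measurable_funM => //; apply: (measurableT_comp (measurable_entry i j)).
Qed.

End vector_functions.

Section norms.
Context (R : realType) (n : nat) (N : 'cV[R]_n -> R).
Hypothesis normN : is_norm N.

Lemma normD x y : N (x + y) <= N x + N y.
Proof. by case: normN. Qed.

Lemma normZ c x : N (c *: x) = `|c| * N x.
Proof. by case: normN. Qed.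

Lemma norm0 : N 0 = 0.
Proof. by rewrite -(scale0r 0) normZ normr0 mul0r. Qed.

Lemma norm_ge0 x : 0 <= N x.
Proof.
have := normD x (- x); rewrite subrr norm0 -scaleN1r normZ normrN1 mul1r.
by rewrite -mulr2n pmulrn_lge0.
Qed.

(** The triangle inequality applied to the expansion of x in the canonical basis
    bounds N x by this quantity. *)
Definition weighted_l1 (x : 'cV[R]_n) : R :=
  \sum_i `|x i 0| * N (delta_mx i 0).

Lemma norm_le_weighted_l1 x : N x <= weighted_l1 x.
Proof.
rewrite {1}(matrix_sum_delta x); under eq_bigr do rewrite big_ord1.
rewrite /weighted_l1; elim/big_rec2 : _ => [|i y1 y2 _ le]; first by rewrite norm0.
by rewrite (le_trans (normD _ _))// normZ lerD.
Qed.

Lemma weighted_l1N x : weighted_l1 (- x) = weighted_l1 x.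
Proof. by apply: eq_bigr => i _; rewrite mxE normrN. Qed.

(** N x < c holds exactly when N q + l (x - q) < c for some rational vector q,
    where l is a weighted l1-norm dominating N. This writes the sublevel set as
    a countable union of sets that are measurable since l is a sum of functions
    of single entries. *)
Lemma measurable_norm : measurable_fun setT N.
Proof.
move=> mT; apply: (measurability _ (RGenInftyO.measurableE R)) => //.
move=> _ [_ [c ->] <-]; rewrite setTI.
pose q2r (q : 'cV[rat]_n) : 'cV[R]_n := map_mx ratr q.
rewrite (_ : _ @^-1` _ = \bigcup_q
  [set x | N (q2r q) + weighted_l1 (x - q2r q) < c]).
  apply: countable_bigcupT_measurable => [|q]; first exact: countableP.
  have mf : measurable_fun setT
      (fun x : 'cV[R]_n => N (q2r q) + weighted_l1 (x - q2r q)).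
    apply: measurable_funD => //; apply: measurable_sum => i.
    apply: measurable_funM => //; apply: measurableT_comp => //.
    under eq_fun do rewrite !mxE.
    by apply: measurable_funB => //; exact: measurable_entry.
  by have := mf measurableT _ (measurable_itv `]-oo, c[); rewrite setTI set_itvNyo.
apply/seteqP; split => [x/=|x [q _]/=]; rewrite in_itv/=; last first.
  apply: le_lt_trans; rewrite -{1}(subrK (q2r q) x) addrC.
  by rewrite (le_trans (normD _ _))// lerD2l norm_le_weighted_l1.
move=> Nxc; pose M := 1 + \sum_i N (delta_mx i 0).
have M0 : 0 < M by rewrite ltr_pwDl// sumr_ge0// => i _; exact: norm_ge0.
(* Here M exceeds the sum of the weights of l, so approximating every entry
   within e makes l (x - q) smaller than (c - N x) / 2. *)
pose e := (c - N x) / M / 2.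
have e0 : 0 < e by rewrite !divr_gt0// subr_gt0.
have /fin_all_exists[q qe] : forall i, exists q : rat, `|x i 0 - ratr q| < e.
  move=> i; have [|q] := @rat_in_itvoo R (x i 0 - e) (x i 0 + e).
    by rewrite ltrD2l gtrN.
  rewrite in_itv/= => qe; exists q; rewrite distrC ltr_distl//.
exists (\col_i q i) => //=.
have small : weighted_l1 (x - q2r (\col_i q i)) <= e * (M - 1).
  rewrite /M addrAC subrr add0r mulr_sumr; apply: ler_sum => i _.
  by rewrite ler_wpM2r ?norm_ge0// !mxE ltW.
have : N (q2r (\col_i q i)) <= N x + weighted_l1 (x - q2r (\col_i q i)).
  rewrite -weighted_l1N -{1}(subrKC x (q2r _)) (le_trans (normD _ _))// lerD2l.
  by rewrite opprB norm_le_weighted_l1.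
have eM : 2 * (e * M) = c - N x.
  by rewrite mulrCA /e mulrA divfK// divfK// gt_eqF.
nra.
Qed.

End norms.

(** * Kernels obtained by mapping a product law *)

(** Composing the kernel with tau gives a kernel, to which the measurability of
    kernel integrals applies. *)
Lemma measurable_integral_kernel_comp dX dX0 dY (X : measurableType dX)
    (X0 : measurableType dX0) (Y : measurableType dY) (R : realType)
    (k : R.-pker X0 ~> Y) (tau : X -> X0) (f : X * Y -> \bar R) :
  measurable_fun setT tau -> measurable_fun setT f ->
  (forall z, 0 <= f z)%E ->
  measurable_fun setT (fun x => \int[k (tau x)]_y f (x, y))%E.
Proof.
move=> mtau mf f0.
pose kt (x : X) : {measure set Y -> \bar R} := k (tau x).
have mkt U : measurable U -> measurable_fun setT (kt ^~ U).
  by move=> mU; exact: (measurableT_comp (measurable_kernel k U mU) mtau).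
pose kt1 := isKernel.Build _ _ _ _ _ kt mkt.
pose ktk : R.-ker X ~> Y := HB.pack kt kt1.
have kt1T x : ktk x setT = 1%E by exact: prob_kernel.
pose kt2 := Kernel_isProbability.Build _ _ _ _ _ ktk kt1T.
pose ktp : R.-pker X ~> Y := HB.pack kt kt1 kt2.
exact: (measurable_fun_integral_sfinite_kernel f ktp).
Qed.

Section mixture_kernel.
Context dX dX0 dY dZ dW (X : measurableType dX) (X0 : measurableType dX0)
  (Y : measurableType dY) (Z : measurableType dZ) (W : measurableType dW)
  (R : realType).
Variables (k : R.-pker X0 ~> Y) (m : probability Z R) (tau : X -> X0)
  (phi : X * Y * Z -> W).
Local Open Scope ereal_scope.

(** The law of phi (x, y, z) when y has law k (tau x) and z is independent of y
    with law m. *)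
Definition mixture_law (mtau : measurable_fun setT tau)
    (mphi : measurable_fun setT phi) (x : X) : set W -> \bar R :=
  pushforward (k (tau x) \x m) (fun yz => phi (x, yz.1, yz.2)).

Hypotheses (mtau : measurable_fun setT tau) (mphi : measurable_fun setT phi).
Local Notation law := (mixture_law mtau mphi).

Let mphi1 x : measurable_fun setT (fun yz : Y * Z => phi (x, yz.1, yz.2)).
Proof.
apply: (measurableT_comp mphi); apply/measurable_fun_pairP; split.
  apply/measurable_fun_pairP; split; first exact: measurable_cst.
  exact: measurable_fst.
exact: measurable_snd.
Qed.

Let law0 x : law x set0 = 0.
Proof. by rewrite /mixture_law /pushforward preimage_set0 measure0. Qed.

Let law_ge0 x A : 0 <= law x A.
Proof. by rewrite /mixture_law /pushforward measure_ge0. Qed.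

Let law_sigma_additive x : semi_sigma_additive (law x).
Proof. by apply: measure_semi_sigma_additive; exact: mphi1. Qed.

HB.instance Definition _ x := isMeasure.Build _ _ _ (law x)
  (law0 x) (law_ge0 x) (@law_sigma_additive x).

Definition mixture_kernel : X -> {measure set W -> \bar R} := law.

Lemma mixture_kernelE x (B : set W) : measurable B ->
  mixture_kernel x B =
  \int[k (tau x)]_y \int[m]_z (\1_B (phi (x, y, z)))%:E.
Proof.
move=> mB; rewrite /mixture_kernel/= /mixture_law /pushforward/=.
apply: eq_integral => y _ /=.
have mphiB : measurable ((fun yz : Y * Z => phi (x, yz.1, yz.2)) @^-1` B).
  by rewrite -[X in measurable X]setTI; exact: mphi1.
set E := xsection _ y.
have mE : measurable E by exact: measurable_xsection.
transitivity (\int[m]_z (\1_E z)%:E); first by rewrite integral_indic// setIT.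
apply: eq_integral => z _; rewrite !indicE; congr (_%:R%:E); congr nat_of_bool.
by rewrite mem_xsection; apply/idP/idP; rewrite !inE.
Qed.

Let measurable_mixture (B : set W) : measurable B ->
  measurable_fun setT (mixture_kernel ^~ B).
Proof.
move=> mB; under eq_fun do rewrite mixture_kernelE//.
have m1 : measurable_fun setT (fun xy : X * Y =>
    \int[m]_z (\1_B (phi (xy.1, xy.2, z)) : R)%:E).
  apply: (measurable_fun_fubini_tonelli_F
    (fun xyz : (X * Y) * Z => (\1_B (phi (xyz.1.1, xyz.1.2, xyz.2)) : R)%:E)).
    apply/measurable_EFinP; apply: (measurableT_comp (measurable_indic mB)).
    rewrite (_ : (fun _ => _) = phi)//.
    by apply/funext => -[[x y] z].
  by move=> z; rewrite lee_fin.
apply: (measurable_integral_kernel_comp k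
  (f := fun xy => \int[m]_z (\1_B (phi (xy.1, xy.2, z)))%:E)) => //.
by move=> xy; apply: integral_ge0 => z _; rewrite lee_fin.
Qed.

HB.instance Definition _ :=
  isKernel.Build _ _ _ _ _ mixture_kernel measurable_mixture.

Let mixture_kernel1 x : mixture_kernel x setT = 1.
Proof.
rewrite /mixture_kernel/= /mixture_law /pushforward preimage_setT.
rewrite -setXTT product_measure1E// prob_kernel mul1e; exact: probability_setT.
Qed.

HB.instance Definition _ :=
  Kernel_isProbability.Build _ _ _ _ _ mixture_kernel mixture_kernel1.

End mixture_kernel.

(** * Disintegration in the presence of independent directions *)

Section disintegration.
Context (R : realType) (F : cumulativeBounded (0 : R) (1 : R)) (g : R -> R).
Local Notation mR := (measurableTypeR R).
Local Notation lambda := (@lebesgue_measure R).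
Local Notation dF := (lebesgue_stieltjes_measure F).
Local Open Scope ereal_scope.
Hypothesis g_pos : positive_density g.
Variable muW : probability mR R.
Hypothesis muWE : forall B, measurable B ->
  muW B = \int[lambda]_(x in B `&` `]0%R, 1%R[) (g x)%:E.
Hypothesis dF0 : dF [set r | (r <= 0)%R] = 0.
Context d (T : measurableType d) (P : probability T R) d1 d4
  (T1 : measurableType d1) (T4 : measurableType d4).
Variables (V : T -> T1) (rho w : T -> mR) (U : T -> T4).
Hypotheses (mV : measurable_fun setT V) (mrho : measurable_fun setT rho)
  (mw : measurable_fun setT w) (mU : measurable_fun setT U).
Variables (mu1 : probability T1 R) (mu4 : probability T4 R).
Hypothesis ind : forall A1 A2 A3 A4,
  measurable A1 -> measurable A2 -> measurable A3 -> measurable A4 ->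
  P (V @^-1` A1 `&` (rho @^-1` A2 `&` (w @^-1` A3 `&` U @^-1` A4))) =
  mu1 A1 * (dF A2 * (muW A3 * mu4 A4)).

(** Integrating out U first leaves, for each value of V, a function of
    (rho w, rho), to which [integral_radial_law] applies. *)
Lemma radial_disintegration (h : T1 * (mR * mR) * T4 -> \bar R) :
  measurable_fun setT h -> (forall z, 0 <= h z) ->
  \int[P]_x h (V x, ((rho x * w x)%R, rho x), U x) =
  \int[P]_x \int[radial_law F g_pos (rho x * w x)%R]_s
    \int[mu4]_y h (V x, ((rho x * w x)%R, s), y).
Proof.
move=> mh h0.
pose H (z : T1 * (mR * mR)) := \int[mu4]_y h (z, y).
have mH : measurable_fun setT H by exact: (measurable_fun_fubini_tonelli_F h).
have H0 z : 0 <= H z by exact: integral_ge0.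
have mHv v : measurable_fun setT (fun z => H (v, z)).
  exact: (measurableT_comp mH (measurable_pair1 v)).
pose Z : measurableType _ := (T1 * (mR * (mR * T4)))%type.
pose f1 (z : Z) :=
  h (z.1, ((z.2.1 * z.2.2.1)%R, z.2.1), z.2.2.2).
pose f2 (z : Z) :=
  \int[radial_law F g_pos (z.2.1 * z.2.2.1)%R]_s
    H (z.1, ((z.2.1 * z.2.2.1)%R, s)).
have m1 : measurable_fun setT (fun z : Z => z.1) by exact: measurable_fst.
have m2 : measurable_fun setT (fun z : Z => z.2.1).
  exact: (measurableT_comp measurable_fst measurable_snd).
have m34 : measurable_fun setT (fun z : Z => z.2.2).
  exact: (measurableT_comp measurable_snd measurable_snd).
have m3 : measurable_fun setT (fun z : Z => z.2.2.1).
  exact: (measurableT_comp measurable_fst m34).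
have m4 : measurable_fun setT (fun z : Z => z.2.2.2).
  exact: (measurableT_comp measurable_snd m34).
have m23 : measurable_fun setT (fun z : Z => (z.2.1 * z.2.2.1)%R : mR).
  exact: measurable_funM.
have mf1 : measurable_fun setT f1.
  apply: (measurableT_comp mh); apply/measurable_fun_pairP; split => //.
  apply/measurable_fun_pairP; split => //.
  by apply/measurable_fun_pairP; split.
have mf2 : measurable_fun setT f2.
  apply: (measurable_integral_kernel_comp (radial_law F g_pos)
    (tau := fun z : Z => (z.2.1 * z.2.2.1)%R : mR)
    (f := fun zs : Z * mR =>
      H (zs.1.1, ((zs.1.2.1 * zs.1.2.2.1)%R, zs.2)))) => //.
  apply: (measurableT_comp mH); apply/measurable_fun_pairP; split.
    exact: (measurableT_comp m1 measurable_fst).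
  apply/measurable_fun_pairP; split; last exact: measurable_snd.
  exact: (measurableT_comp m23 measurable_fst).
have f20 z : 0 <= f2 z by exact: integral_ge0.
transitivity (\int[mu1]_v \int[dF]_r \int[muW]_w H (v, ((r * w)%R, r))).
  exact: (ge0_integral_independent4 (f := f1) mV mrho mw mU ind mf1 (fun=> h0 _)).
transitivity (\int[mu1]_v \int[dF]_r \int[muW]_w \int[mu4]_y f2 (v, (r, (w, y)))).
  apply: eq_integral => v _.
  have := integral_radial_law g_pos muWE dF0 (mHv v) (fun=> H0 _).
  move=> ->; apply: eq_integral => r _; apply: eq_integral => w' _.
  exact: (esym (integral_probability_cst mu4
    (\int[radial_law F g_pos (r * w')%R]_s H (v, ((r * w')%R, s))))).
exact/esym/(ge0_integral_independent4 (f := f2) mV mrho mw mU ind mf2 f20).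
Qed.

Lemma radial_finite_law : {ae P, forall x, radial_finite F g_pos (rho x * w x)%R}.
Proof.
pose B := ~` radial_finite F g_pos.
have mB : measurable B by apply: measurableC; exact: measurable_radial_finite.
pose f (z : T1 * (mR * (mR * T4))) : \bar R := (\1_B (z.2.1 * z.2.2.1)%R)%:E.
have m34 : measurable_fun setT (fun z : T1 * (mR * (mR * T4)) => z.2.2).
  exact: (measurableT_comp measurable_snd measurable_snd).
have m23 : measurable_fun setT
    (fun z : T1 * (mR * (mR * T4)) => (z.2.1 * z.2.2.1)%R : mR).
  apply: measurable_funM.
    exact: (measurableT_comp measurable_fst measurable_snd).
  exact: (measurableT_comp measurable_fst m34).
have mf : measurable_fun setT f.
  by apply/measurable_EFinP; exact: (measurableT_comp (measurable_indic mB) m23).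
have f0 z : 0 <= f z by rewrite lee_fin.
have mrw : measurable_fun setT (fun x => (rho x * w x)%R : mR).
  exact: measurable_funM.
have mE : measurable ((fun x => (rho x * w x)%R : mR) @^-1` B).
  by rewrite -[X in measurable X]setTI; exact: mrw.
set E := _ @^-1` B in mE; exists E; split => //.
transitivity (\int[P]_x (\1_E x)%:E); first by rewrite integral_indic// setIT.
apply: (eq_trans (ge0_integral_independent4 (f := f) mV mrho mw mU ind mf f0)).
transitivity (\int[mu1]_v (cst 0 v)); last exact: integral0.
apply: eq_integral => v _.
rewrite -(radial_finite_ae g_pos muWE dF0).
apply: eq_integral => r _; apply: eq_integral => w' _.
exact: (integral_probability_cst mu4 (\1_B (r * w')%R)%:E).
Qed.

End disintegration.

(** * The conditional distribution of a scale mixture *)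

Section scale_mixture.
Context (R : realType) (n : nat) (I : {set 'I_n})
  (NI : 'cV[R]_#|I| -> R) (NJ : 'cV[R]_#|~: I| -> R) (normJ : is_norm NJ)
  (p : R) (p_gt0 : 0 < p) (A : 'M[R]_n)
  (F : cumulativeBounded (0 : R) (1 : R)) (g : R -> R)
  (d : measure_display) (T : measurableType d) (P : probability T R)
  (X : {RV P >-> 'cV[R]_n})
  (d' : measure_display) (T' : measurableType d') (P' : probability T' R)
  (Rad Wp : {RV P' >-> R}) (U S : {RV P' >-> 'cV[R]_n})
  (mixture : Wp_scale_mixture A F g p NI NJ X Rad Wp U S)
  (A_JI : submat (~: I) I A = 0)
  (AJJ : submat (~: I) (~: I) A \in unitmx).
Local Notation J := (~: I).
Local Notation mR := (measurableTypeR R).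
Local Notation lambda := (@lebesgue_measure R).
Local Notation dF := (lebesgue_stieltjes_measure F).
Local Open Scope ereal_scope.

Let rho : T' -> mR := Rad.
Let w : T' -> mR := Wp.
Let u : T' -> 'cV[R]_#|I| := subvec I \o U.
Let v : T' -> 'cV[R]_#|J| := subvec J \o U.

Let mrho : measurable_fun setT rho. Proof. exact: (measurable_funP Rad). Qed.
Let mw : measurable_fun setT w. Proof. exact: (measurable_funP Wp). Qed.
Let mu : measurable_fun setT u.
Proof.
exact: (measurableT_comp (@measurable_subvec R n _) (measurable_funP U)).
Qed.
Let mv : measurable_fun setT v.
Proof.
exact: (measurableT_comp (@measurable_subvec R n _) (measurable_funP U)).
Qed.

Let rho_mfun : {mfun T' >-> mR} :=
  HB.pack rho (isMeasurableFun.Build _ _ _ _ _ mrho).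
Let w_mfun : {mfun T' >-> mR} := HB.pack w (isMeasurableFun.Build _ _ _ _ _ mw).
Let u_mfun : {mfun T' >-> 'cV[R]_#|I|} :=
  HB.pack u (isMeasurableFun.Build _ _ _ _ _ mu).
Let v_mfun : {mfun T' >-> 'cV[R]_#|J|} :=
  HB.pack v (isMeasurableFun.Build _ _ _ _ _ mv).

Let muW := distribution P' w_mfun.
Let muU := distribution P' u_mfun.
Let muV := distribution P' v_mfun.

Let mpre dY (Y : measurableType dY) (f : T' -> Y) B :
  measurable_fun setT f -> measurable B -> measurable (f @^-1` B).
Proof. by move=> mf mB; rewrite -[X in measurable X]setTI; exact: mf. Qed.

Lemma mixture_positive_density : positive_density g.
Proof.
have [mg g0 _] := Wp_density mixture; split; first exact: mg.
by move=> x x01; apply: g0; rewrite /= in_itv.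
Qed.
Let g_pos := mixture_positive_density.

Lemma weight_law (B : set mR) : measurable B ->
  muW B = \int[lambda]_(x in B `&` `]0%R, 1%R[) (g x)%:E.
Proof. by have [_ _ h] := Wp_density mixture; exact: h. Qed.

Lemma radius_law (B : set mR) : measurable B -> P' (rho @^-1` B) = dF B.
Proof.
move=> mB; apply: (@law_stieltjes R F (distribution P' rho_mfun)) => // x.
exact: (Rad_df mixture).
Qed.

Lemma stieltjes_le0 : dF [set r | (r <= 0)%R] = 0.
Proof.
have mN : measurable ([set r | (r <= 0)%R] : set mR).
  by rewrite -set_itvNyc; exact: measurable_itv.
rewrite -[LHS]radius_law//; apply/measure_negligible; first exact: mpre.
apply: negligibleS (Rad_gt0 mixture) => x /=.
by rewrite leNgt => /negP.
Qed.

Lemma mixture_ae : {ae P', forall x,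
  [/\ (0 < rho x)%R, (0 <= w x <= 1)%R & NJ (v x) = 1%R]}.
Proof.
apply: filterS3 (Rad_gt0 mixture) (Wp_itv mixture) (U_sphere mixture).
by move=> x h1 h2 [_ h3]; split.
Qed.

Let weight_of (y : R) : R := ((1 - y `^ p) `^ p^-1)%R.

Let mweight_of : measurable_fun setT weight_of.
Proof.
apply: (measurableT_comp (measurable_powR p^-1)).
by apply: measurable_funB => //; exact: measurable_powR.
Qed.

Lemma compl_weight_ae : {ae P', forall x, weight_of (compl_weight p Wp x) = w x}.
Proof.
by apply: filterS mixture_ae => x [_ w01 _]; exact: compl_weightK.
Qed.

(** Independence is assumed for W; it is inherited by W_p, which is almost surely
    a function of W by [compl_weightK]. *)
Lemma mixture_independent A1 A2 A3 A4 :
  measurable A1 -> measurable A2 -> measurable A3 -> measurable A4 ->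
  P' (v @^-1` A1 `&` (rho @^-1` A2 `&` (w @^-1` A3 `&` u @^-1` A4))) =
  muV A1 * (dF A2 * (muW A3 * muU A4)).
Proof.
move=> mA1 mA2 mA3 mA4.
have mC : measurable_fun setT (compl_weight p Wp).
  exact: (measurableT_comp mweight_of mw).
have mW : measurable_fun setT (weight_of \o compl_weight p Wp).
  exact: (measurableT_comp mweight_of mC).
pose W3 := (weight_of \o compl_weight p Wp) @^-1` A3.
have mW3 : measurable W3 by exact: mpre.
have -> : muW A3 = P' W3.
  rewrite -[LHS]/(P' (w @^-1` A3)); apply: ae_measure_eq => //.
    exact: mpre.
  by apply: filterS compl_weight_ae => x; rewrite /W3/= => ->.
transitivity (P' (v @^-1` A1 `&` (rho @^-1` A2 `&` (W3 `&` u @^-1` A4)))).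
  apply: ae_measure_eq.
  - by do 3?[apply: measurableI => //]; exact: mpre.
  - by do 3?[apply: measurableI => //]; exact: mpre.
  by apply: filterS compl_weight_ae => x; rewrite /W3/= => ->.
have -> : v @^-1` A1 `&` (rho @^-1` A2 `&` (W3 `&` u @^-1` A4)) =
  rho @^-1` A2 `&` (W3 `&` (u @^-1` A4 `&` v @^-1` A1)).
  by rewrite setIC -!setIA.
rewrite (mutually_independent4 (indep_RWU mixture)).
- by rewrite radius_law// [RHS]muleC -!muleA.
- by exists A2 => //; rewrite setTI.
- exists (weight_of @^-1` A3); last by rewrite setTI.
  by rewrite -[X in measurable X]setTI; exact: mweight_of.
- by exists A4 => //; rewrite setTI.
- by exists A1 => //; rewrite setTI.
Qed.

Lemma mixture_J x :
  subvec J (A *m S x) = ((rho x * w x) *: (submat J J A *m v x))%R.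
Proof.
by rewrite (subvec_mulmx _ I) A_JI mul0mx add0r (S_J mixture) -scalemxAr.
Qed.

Lemma mixture_I x : (0 < rho x)%R -> (0 <= w x <= 1)%R ->
  subvec I (A *m S x) =
  (submat I I A *m (leg p (rho x * w x) (rho x) *: u x)
   + submat I J A *m ((rho x * w x) *: v x))%R.
Proof.
move=> r0 w01.
by rewrite (subvec_mulmx _ I) (S_I mixture) (S_J mixture) leg_weight.
Qed.

Let tau : 'cV[R]_#|J| -> mR := norm_sub A NJ.

Let mtau : measurable_fun setT tau.
Proof.
exact: (measurableT_comp (@measurable_norm R _ _ normJ)
  (@measurable_mulmx R _ _ _)).
Qed.

(** U_J is on the unit sphere, so the norm of A_JJ^-1 X_J recovers R W_p. *)
Lemma norm_sub_mixture x : (0 < rho x)%R -> (0 <= w x)%R -> NJ (v x) = 1%R ->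
  tau (subvec J (A *m S x)) = (rho x * w x)%R.
Proof.
move=> r0 w0 v1; rewrite mixture_J /tau /norm_sub -scalemxAr mulKmx//.
by rewrite (normZ normJ) v1 mulr1 ger0_norm// mulr_ge0// ltW.
Qed.

(** The value of X_I when X_J, R and U_I have the values z.1.1, z.1.2 and z.2. *)
Definition cond_map (z : 'cV[R]_#|J| * mR * 'cV[R]_#|I|) : 'cV[R]_#|I| :=
  (submat I I A *m (leg p (tau z.1.1) z.1.2 *: z.2)
   + submat I J A *m invmx (submat J J A) *m z.1.1)%R.

Lemma measurable_cond_map : measurable_fun setT cond_map.
Proof.
have m11 : measurable_fun setT
    (fun z : 'cV[R]_#|J| * mR * 'cV[R]_#|I| => z.1.1).
  exact: (measurableT_comp measurable_fst measurable_fst).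
have m12 : measurable_fun setT
    (fun z : 'cV[R]_#|J| * mR * 'cV[R]_#|I| => z.1.2).
  exact: (measurableT_comp measurable_snd measurable_fst).
have mpair : measurable_fun setT (fun z : 'cV[R]_#|J| * mR * 'cV[R]_#|I| =>
    (tau z.1.1, z.1.2)).
  apply/measurable_fun_pairP; split => //.
  exact: (measurableT_comp mtau m11).
apply: measurable_addmx; last first.
  exact: (measurableT_comp (@measurable_mulmx R _ _ _) m11).
apply: (measurableT_comp (@measurable_mulmx R _ _ _)).
apply: measurable_scalemx; last exact: measurable_snd.
exact: (measurableT_comp (measurable_leg p) mpair).
Qed.

Definition cond_kernel : R.-pker 'cV[R]_#|J| ~> 'cV[R]_#|I| :=
  mixture_kernel (radial_law F g_pos) muU mtau measurable_cond_map.

(** X and A S have the same law but may live on different sample spaces. *)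
Lemma mixture_transfer (f : 'cV[R]_n -> \bar R) :
  measurable_fun setT f -> (forall a, 0 <= f a) ->
  \int[P]_x f (X x) = \int[P']_x f (A *m S x)%R.
Proof.
move=> mf f0.
have mAS : measurable_fun setT (fun x => A *m S x)%R.
  exact: (measurableT_comp (@measurable_mulmx R _ _ _) (measurable_funP S)).
have e1 := ge0_integral_pushforward (measurable_funP X) P measurableT mf.
have e2 := ge0_integral_pushforward mAS P' measurableT mf.
rewrite preimage_setT in e1; rewrite preimage_setT in e2.
rewrite -[LHS]e1; last by move=> *; exact: f0.
rewrite -[RHS]e2; last by move=> *; exact: f0.
by apply: eq_measure_integral => B mB _; exact: (X_AS mixture).
Qed.

(** Both sides are transferred to the sample space of S. There the left one is
    the mean of h (U_J, (R W_p, R), U_I), and the right one is the mean of the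
    same function with R and U_I integrated out under [radial_law] and the law of
    U_I. These means agree by [radial_disintegration]. *)
Lemma cond_kernel_distribution :
  is_cond_distribution P (subvec I \o X) (subvec J \o X) cond_kernel.
Proof.
move=> B C mB mC.
have mAS : measurable_fun setT (fun x => A *m S x)%R.
  exact: (measurableT_comp (@measurable_mulmx R _ _ _) (measurable_funP S)).
have msI := @measurable_subvec R n I; have msJ := @measurable_subvec R n J.
pose D : set 'cV[R]_n := subvec I @^-1` B `&` subvec J @^-1` C.
have mD : measurable D.
  apply: measurableI; rewrite -[X in measurable X]setTI; first exact: msI.
  exact: msJ.
pose G (a : 'cV[R]_n) : \bar R :=
  (\1_C (subvec J a))%:E * cond_kernel (subvec J a) B.
have mG : measurable_fun setT G.
  apply: emeasurable_funM.
    by apply/measurable_EFinP; exact: (measurableT_comp (measurable_indic mC) msJ).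
  exact: (measurableT_comp (measurable_kernel cond_kernel B mB) msJ).
have G0 a : 0 <= G a by rewrite mule_ge0// lee_fin.
transitivity (\int[P']_x G (A *m S x)%R); last first.
  rewrite -mixture_transfer// [RHS]integral_mkcond; apply: eq_integral => x _.
  rewrite patchE /G /= indicE; case: ifPn => xC.
    by rewrite mem_set ?mul1e//; move: xC; rewrite inE.
  by rewrite memNset ?mul0e//; move: xC; rewrite notin_setE.
pose h (z : 'cV[R]_#|J| * (mR * mR) * 'cV[R]_#|I|) : \bar R :=
  (\1_C (z.1.2.1 *: (submat J J A *m z.1.1)))%:E *
  (\1_B (submat I I A *m (leg p z.1.2.1 z.1.2.2 *: z.2)
          + submat I J A *m (z.1.2.1 *: z.1.1)))%:E.
have mh : measurable_fun setT h.
  pose Z : measurableType _ := ('cV[R]_#|J| * (mR * mR) * 'cV[R]_#|I|)%type.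
  have m1 : measurable_fun setT (fun z : Z => z.1) by exact: measurable_fst.
  have m2 : measurable_fun setT (fun z : Z => z.2) by exact: measurable_snd.
  have m11 : measurable_fun setT (fun z : Z => z.1.1).
    exact: (measurableT_comp measurable_fst m1).
  have m12 : measurable_fun setT (fun z : Z => z.1.2).
    exact: (measurableT_comp measurable_snd m1).
  have m121 : measurable_fun setT (fun z : Z => z.1.2.1).
    exact: (measurableT_comp measurable_fst m12).
  have mleg : measurable_fun setT (fun z : Z => leg p z.1.2.1 z.1.2.2).
    exact: (measurableT_comp (measurable_leg p) m12).
  apply: emeasurable_funM; apply/measurable_EFinP.
    apply: (measurableT_comp (measurable_indic mC)).
    apply: measurable_scalemx => //.
    exact: (measurableT_comp (@measurable_mulmx R _ _ _) m11).
  apply: (measurableT_comp (measurable_indic mB)).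
  apply: measurable_addmx.
    apply: (measurableT_comp (@measurable_mulmx R _ _ _)).
    exact: measurable_scalemx.
  apply: (measurableT_comp (@measurable_mulmx R _ _ _)).
  exact: measurable_scalemx.
have h0 z : 0 <= h z by rewrite mule_ge0// lee_fin.
have mrw : measurable_fun setT (fun x => (rho x * w x)%R : mR).
  exact: measurable_funM.
have mhP : measurable_fun setT
    (fun x => h (v x, ((rho x * w x)%R, rho x), u x)).
  apply: (measurableT_comp mh); apply/measurable_fun_pairP; split => //.
  apply/measurable_fun_pairP; split => //.
  by apply/measurable_fun_pairP; split.
transitivity (\int[P']_x h (v x, ((rho x * w x)%R, rho x), u x)).
  transitivity (P' ((fun x => A *m S x)%R @^-1` D)).
    exact: (X_AS mixture mD).
  have mE : measurable ((fun x => A *m S x)%R @^-1` D) by exact: mpre.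
  set E := _ @^-1` D in mE *.
  transitivity (\int[P']_x (\1_E x)%:E); first by rewrite integral_indic// setIT.
  apply: ge0_ae_eq_integral => //; first exact/measurable_EFinP.
  apply: filterS mixture_ae => x [r0 w01 v1] _.
  rewrite /h/= -mixture_I// -mixture_J -EFinM; congr EFin.
  rewrite !indicE -natrM mulnb; congr (_%:R); congr nat_of_bool.
  apply/idP/andP => [|[]]; rewrite !inE /E/D/=; first by case.
  by move=> ? ?; split.
have := radial_disintegration (U := u) (V := v) g_pos weight_law stieltjes_le0
  mv mrho mw mu mixture_independent mh h0.
move=> ->.
apply: ge0_ae_eq_integral.
- exact: measurableT.
- have mH : measurable_fun setT (fun z => \int[muU]_y h (z, y)).
    exact: (measurable_fun_fubini_tonelli_F h).
  apply: (measurable_integral_kernel_comp (radial_law F g_pos)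
    (tau := fun x => (rho x * w x)%R : mR) (f := fun xs : T' * mR =>
      \int[muU]_y h (v xs.1, ((rho xs.1 * w xs.1)%R, xs.2), y))) => //.
    have mf : measurable_fun setT (fun xs : T' * mR =>
        (v xs.1, (((rho xs.1 * w xs.1)%R : mR), xs.2))).
      apply/measurable_fun_pairP; split.
        exact: (measurableT_comp mv measurable_fst).
      apply/measurable_fun_pairP; split; last exact: measurable_snd.
      exact: (measurableT_comp mrw measurable_fst).
    exact: (measurableT_comp mH mf).
  by move=> xs; exact: integral_ge0.
- exact: (measurableT_comp mG mAS).
- by move=> x _; apply: integral_ge0 => s _; exact: integral_ge0.
- by move=> x _; exact: G0.
apply: filterS mixture_ae => x [r0 w01 v1] _.
have /andP[w0 _] := w01.
pose b (sy : mR * 'cV[R]_#|I|) : \bar R :=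
  (\1_B (cond_map (subvec J (A *m S x)%R, sy.1, sy.2)))%:E.
have mb : measurable_fun setT b.
  have mf : measurable_fun setT (fun sy : mR * 'cV[R]_#|I| =>
      (subvec J (A *m S x)%R, sy.1, sy.2)).
    apply/measurable_fun_pairP; split; last exact: measurable_snd.
    apply/measurable_fun_pairP; split; last exact: measurable_fst.
    exact: measurable_cst.
  apply/measurable_EFinP; apply: (measurableT_comp (measurable_indic mB)).
  exact: (measurableT_comp measurable_cond_map mf).
have b0 sy : 0 <= b sy by rewrite lee_fin.
rewrite /G [X in _ = _ * X]mixture_kernelE// norm_sub_mixture//.
set c : \bar R := (\1_C _)%:E.
have c0 : 0 <= c by rewrite lee_fin.
have mb1 := measurable_fun_fubini_tonelli_F (m2 := muU) b mb b0.
have mb2 s : measurable_fun setT (fun y => b (s, y)).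
  exact: (measurableT_comp mb (measurable_pair1 s)).
have Ib0 s : setT s -> 0 <= fubini_F muU b s.
  by move=> _; exact: integral_ge0.
have e1 := ge0_integralZl (radial_law F g_pos (rho x * w x)%R) measurableT mb1
  Ib0 c0.
apply: (eq_trans _ e1); apply: eq_integral => s _.
have e2 := ge0_integralZl muU measurableT (mb2 s) (fun y _ => b0 (s, y)) c0.
apply: (eq_trans _ e2); apply: eq_integral => y _.
rewrite /h/= /c /b/= /cond_map/= norm_sub_mixture// mixture_J.
congr (_ * (\1_B (_ + _))%:E).
by rewrite scalemxAr -!mulmxA mulKmx.
Qed.

(** R > 0 almost surely gives F 0 = 0. *)
Lemma norm_sub_gt0 a : (0 < F (tau a))%R -> (0 < tau a)%R.
Proof.
move=> Fa; rewrite lt_neqAle (norm_ge0 normJ) andbT; apply/eqP => a0.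
have : (F 0%R)%:E = 0%E.
  rewrite -stieltjes_le (_ : `]-oo, 0%R]%classic = [set r | (r <= 0)%R]).
    exact: stieltjes_le0.
  exact: set_itvNyc.
by move=> [F0]; rewrite -a0 F0 ltxx in Fa.
Qed.

Lemma mixture_radial_integrable : {ae P, forall x,
  let t := tau (subvec J (X x)) in
  (0 < F t < 1)%R -> radial_integrable F g t}.
Proof.
pose B := ~` radial_finite F g_pos.
have mB : measurable B by apply: measurableC; exact: measurable_radial_finite.
have mtJ : measurable_fun setT (fun a : 'cV[R]_n => tau (subvec J a)).
  exact: (measurableT_comp mtau (@measurable_subvec R n J)).
pose E := (fun a : 'cV[R]_n => tau (subvec J a)) @^-1` B.
have mE : measurable E by rewrite -[X in measurable X]setTI; exact: mtJ.
have mAS : measurable_fun setT (fun x => A *m S x)%R.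
  exact: (measurableT_comp (@measurable_mulmx R _ _ _) (measurable_funP S)).
exists (X @^-1` E); split.
- by rewrite -[X in measurable X]setTI; exact: measurable_funP.
- apply: (eq_trans (X_AS mixture mE)); apply/measure_negligible.
    exact: mpre.
  have fin := radial_finite_law g_pos weight_law stieltjes_le0 mv mrho mw mu
    mixture_independent.
  have : {ae P', forall x, ~ E (A *m S x)%R}.
    apply: filterS2 fin mixture_ae => x fx [r0 /andP[w0 _] v1].
    by rewrite /E/= norm_sub_mixture//; apply.
  by apply: negligibleS => x Ex; apply.
move=> x/= /not_implyP[/andP[F0 _] nint] /=.
apply: contra_not nint => fin; apply/radial_integrableE => //.
exact: norm_sub_gt0.
Qed.

(** The witness space is the product of the real line, with [radial_law], and
    R^I, with the law of U_I. *)
Lemma cond_kernel_representation (a : 'cV[R]_#|J|) :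
  (0 < F (tau a) < 1)%R -> radial_integrable F g (tau a) ->
  exists (d2 : measure_display) (T2 : measurableType d2)
    (P2 : probability T2 R)
    (R_a : {RV P2 >-> R}) (V : {RV P2 >-> 'cV[R]_#|I|}),
    [/\ {ae P2, forall z, (0 < R_a z)%R},
        forall z, cdf R_a z = (Qdf p F g (tau a) z)%:E,
        eq_distribution P2 V P' (subvec I \o U),
        mutually_independent P2 [:: sigma_of R_a; sigma_of V]
      & forall B, measurable B ->
          cond_kernel a B =
          P2 ((fun z => submat I I A *m (R_a z *: V z)
                + submat I J A *m invmx (submat J J A) *m a)%R @^-1` B)].
Proof.
set t := tau a => /andP[Ft0 Ft1] fint.
have t0 : (0 < t)%R by exact: norm_sub_gt0.
pose T2 : measurableType _ := (mR * 'cV[R]_#|I|)%type.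
pose law : probability mR R := mnormalize (radial_kernel F g_pos t) dF.
pose P2 : probability T2 R := law \x muU.
have mR_a : measurable_fun setT (fun z : T2 => leg p t z.1).
  exact: (measurableT_comp (measurable_leg1 t p) measurable_fst).
have mV : measurable_fun setT (fun z : T2 => z.2) by exact: measurable_snd.
pose R_a : {RV P2 >-> R} :=
  HB.pack (fun z : T2 => leg p t z.1) (isMeasurableFun.Build _ _ _ _ _ mR_a).
pose V : {RV P2 >-> 'cV[R]_#|I|} :=
  HB.pack (fun z : T2 => z.2) (isMeasurableFun.Build _ _ _ _ _ mV).
have mlegB (B : set R) : measurable B -> measurable (leg p t @^-1` B : set mR).
  by move=> mB; rewrite -[X in measurable X]setTI; exact: measurable_leg1.
have P2R (B : set R) : measurable B ->
    P2 (R_a @^-1` B) = law (leg p t @^-1` B).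
  move=> mB; rewrite (_ : _ @^-1` _ = (leg p t @^-1` B) `*` setT).
    rewrite [LHS]product_measure1E//; last exact: mlegB.
    by rewrite -[RHS]mule1; congr (_ * _); exact: probability_setT.
  by apply/seteqP; split => -[r y] /=; [split|case].
have P2V (B : set 'cV[R]_#|I|) : measurable B -> P2 (V @^-1` B) = muU B.
  move=> mB; rewrite (_ : _ @^-1` _ = setT `*` B).
    rewrite [LHS]product_measure1E//.
    by rewrite -[RHS]mul1e; congr (_ * _); exact: probability_setT.
  by apply/seteqP; split => -[r y] /=; [split|case].
have cdfR z : cdf R_a z = (Qdf p F g t z)%:E.
  rewrite -(cdf_radial_law g_pos t0 Ft1 fint z p_gt0).
  apply: (eq_trans (P2R _ (measurable_itv _))).
  by rewrite set_itvNyc.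
exists _, T2, P2, R_a, V; split => //.
- exists (R_a @^-1` `]-oo, 0%R]); split.
  + by rewrite -[X in measurable X]setTI; exact: (measurable_funP R_a).
  + by have := cdfR 0%R; rewrite /Qdf ltxx.
  + by move=> z /= /negP; rewrite -leNgt in_itv.
- apply: mutually_independent2.
  + by exists setT => //; rewrite setTI preimage_setT.
  + by exists setT => //; rewrite setTI preimage_setT.
  move=> _ _ [B1 mB1 <-] [B2 mB2 <-]; rewrite !setTI.
  rewrite [in RHS]P2R// [in RHS]P2V//.
  rewrite (_ : _ `&` _ = (leg p t @^-1` B1) `*` B2).
    by apply: product_measure1E => //; exact: mlegB.
  by apply/seteqP; split.
Qed.

End scale_mixture.

Unset Implicit Arguments.

Theorem theorem2p2 (R : realType) (n : nat) (n_ge2 : (2 <= n)%N)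
    (I : {set 'I_n}) (I_neq0 : I != finset.set0) (I_lt : (#|I| < n)%N)
    (NI : 'cV[R]_#|I| -> R) (NJ : 'cV[R]_#|~: I| -> R)
    (normI : is_norm NI) (normJ : is_norm NJ)
    (p : R) (p_gt0 : 0 < p) (A : 'M[R]_n)
    (F : cumulativeBounded (0 : R) (1 : R)) (g : R -> R)
    (d : measure_display) (T : measurableType d) (P : probability T R)
    (X : {RV P >-> 'cV[R]_n})
    (d' : measure_display) (T' : measurableType d') (P' : probability T' R)
    (Rad Wp : {RV P' >-> R}) (U S : {RV P' >-> 'cV[R]_n})
    (mixture : Wp_scale_mixture A F g p NI NJ X Rad Wp U S)
    (A_JI : submat (~: I) I A = 0)
    (A1 : assumption_A1 A NJ U) :
  exists kappa : R.-pker 'cV[R]_#|~: I| ~> 'cV[R]_#|I|,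
    [/\ is_cond_distribution P (subvec I \o X) (subvec (~: I) \o X) kappa,
        {ae P, forall w, let tau := norm_sub A NJ (subvec (~: I) (X w)) in
           0 < F tau < 1 -> radial_integrable F g tau}
      & forall a : 'cV[R]_n,
          let a_J := subvec (~: I) a in
          let tau := norm_sub A NJ a_J in
          0 < F tau < 1 -> radial_integrable F g tau ->
          exists (d2 : measure_display) (T2 : measurableType d2)
            (P2 : probability T2 R)
            (R_a : {RV P2 >-> R}) (V : {RV P2 >-> 'cV[R]_#|I|}),
            [/\ {ae P2, forall w, 0 < R_a w},
                forall z, cdf R_a z = (Qdf p F g tau z)%:E,
                eq_distribution P2 V P' (subvec I \o U),
                mutually_independent P2 [:: sigma_of R_a; sigma_of V]
              & forall B, measurable B ->
                  kappa a_J B =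
                  P2 ((fun w => submat I I A *m (R_a w *: V w)
                        + submat I (~: I) A *m invmx (submat (~: I) (~: I) A)
                          *m a_J) @^-1` B)]].
Proof.
have AJJ : submat (~: I) (~: I) A \in unitmx by case: A1.
exists (cond_kernel normJ mixture); split.
- exact (cond_kernel_distribution normJ p_gt0 mixture A_JI AJJ).
- exact (mixture_radial_integrable normJ p_gt0 mixture A_JI AJJ).
- move=> a.
  exact (cond_kernel_representation normJ p_gt0 mixture
    (a := subvec (~: I) a)).
Qed.
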